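(* Let $V$ be a vertex operator algebra, $p$ a positive integer, $\omega_p$ a primitive $p$-th root of unity, $\nu$ an automorphism of $V$ with $\nu^p=1_V$, and $M$ a $\mathbb Q$-graded $\nu$-twisted $V$-module. For $u,v\in V$, $$x_0^{-1}\delta\Big(\frac{x_1-x_2}{x_0}\Big)X_M(u,x_1)X_M(v,x_2)-x_0^{-1}\delta\Big(\frac{x_2-x_1}{-x_0}\Big)X_M(v,x_2)X_M(u,x_1)$$ $$=\frac1p\,x_1^{-1}\sum_{r=0}^{p-1}\delta\Big(\omega_p^{-r}\Big(e^y\frac{x_2}{x_1}\Big)^{1/p}\Big)X_M(Y[\nu^ru,y]v,x_2),$$ where $y=\log\big(1+\frac{x_0}{x_2}\big)$.
   Context: Vector spaces are over $\mathbb C$; $x,x_0,x_1,x_2$ are commuting formal variables; $\delta(x)=\sum_{n\in\mathbb Z}x^n$. The symbol $x^{1/p}$ is a formal variable whose $p$-th power is $x$. Binomial expansion convention: a (possibly fractional) power of a binomial is expanded in nonnegative integral powers of the second variable. $\log(1+x)$ and $e^y$ are the usual power series; so $e^yx_2=x_2+x_0$ when $y=\log(1+x_0/x_2)$. A vertex operator algebra $(V,Y,\mathbf 1,\omega)$ is a $\mathbb Z$-graded space $V=\coprod_n V_{(n)}$ with $V_{(n)}=0$ for $n$ sufficiently negative and $\dim V_{(n)}<\infty$, with a linear map $v\mapsto Y(v,x)=\sum_{n\in\mathbb Z}v_nx^{-n-1}\in(\mathrm{End}\,V)[[x,x^{-1}]]$ and vectors $\mathbf 1,\omega\in V$ such that: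 for $v,w\in V$, $v_nw=0$ for $n$ large; $Y(\mathbf 1,x)=1_V$; $Y(v,x)\mathbf 1\in V[[x]]$ with constant term $v$; writing $Y(\omega,x)=\sum_n L(n)x^{-n-2}$, $[L(m),L(n)]=(m-n)L(m+n)+c_V\frac{m^3-m}{12}\delta_{m+n,0}1_V$ for some $c_V\in\mathbb C$, $L(0)v=nv$ for $v\in V_{(n)}$, $Y(L(-1)u,x)=\frac{d}{dx}Y(u,x)$; and the Jacobi identity $x_0^{-1}\delta\big(\frac{x_1-x_2}{x_0}\big)Y(u,x_1)Y(v,x_2)-x_0^{-1}\delta\big(\frac{x_2-x_1}{-x_0}\big)Y(v,x_2)Y(u,x_1)=x_2^{-1}\delta\big(\frac{x_1-x_0}{x_2}\big)Y(Y(u,x_0)v,x_2)$. An automorphism $\nu$ of $V$ is a linear automorphism fixing $\omega$ and $\mathbf 1$ with $\nu Y(v,x)\nu^{-1}=Y(\nu v,x)$ for $v\in V$. A ($\mathbb Q$-graded) $\nu$-twisted $V$-module is a $\mathbb Q$-graded space $M=\coprod_{n\in\mathbb Q}M_{(n)}$ with $M_{(n)}=0$ for $n$ sufficiently negative and $\dim M_{(n)}<\infty$, with a linear map $v\mapsto Y_M(v,x)=\sum_{n\in\frac1p\mathbb Z}v_n^\nu x^{-n-1}\in(\mathrm{End}\,M)[[x^{1/p},x^{-1/p}]]$ such that: for $v\in V$, $w\in M$, $v_n^\nu w=0$ for $n$ large; $Y_M(\mathbf 1,x)=1_M$; $Y_M(\omega,x)=\sum_{n\in\mathbb Z}L_M(n)x^{-n-2}$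 with $[L_M(m),L_M(n)]=(m-n)L_M(m+n)+c_V\frac{m^3-m}{12}\delta_{m+n,0}1_M$, $L_M(0)w=nw$ for $w\in M_{(n)}$, $Y_M(L(-1)u,x)=\frac{d}{dx}Y_M(u,x)$; and the twisted Jacobi identity $x_0^{-1}\delta\big(\frac{x_1-x_2}{x_0}\big)Y_M(u,x_1)Y_M(v,x_2)-x_0^{-1}\delta\big(\frac{x_2-x_1}{-x_0}\big)Y_M(v,x_2)Y_M(u,x_1)=\frac1px_2^{-1}\sum_{r=0}^{p-1}\delta\Big(\omega_p^r\big(\frac{x_1-x_0}{x_2}\big)^{1/p}\Big)Y_M(Y(\nu^ru,x_0)v,x_2)$. Homogeneous twisted vertex operators: $X_M(u,x)=Y_M(x^{L(0)}u,x)$, where $x^{L(0)}u=x^nu$ for $u\in V_{(n)}$, extended linearly. Zhu's operators: $Y[u,y]=Y(e^{yL(0)}u,e^y-1)$, where negative powers of $e^y-1\in y\mathbb C[[y]]$ are taken in $\mathbb C((y))$. *)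

(* Defs.v *)
From HB Require Import structures.
From mathcomp Require Import all_boot all_order all_algebra.
From mathcomp Require Import complex.
From mathcomp Require Import boolp classical_sets functions cardinality fsbigop.
From mathcomp Require Import reals.

Set Implicit Arguments.
Unset Strict Implicit.
Unset Printing Implicit Defensive.

Import Order.TTheory GRing.Theory Num.Theory.
Local Open Scope classical_set_scope.
Local Open Scope ring_scope.

(* A formal series is its coefficient function G -> W on a group G of
   exponents: G = int for Laurent series in y, and G = expo below for series in
   x0, x1, x2 with rational exponents.  Sums [\sum_(i \in [set: I]) _] are sums
   of finitely supported families; every coefficient formed below is such a
   sum when p > 0, thanks to the truncation axioms, so the default value 0 of
   fsbigop plays no role. *)

Definition mono (G : choiceType) (W : zmodType) (m : G) (w : W) : G -> W :=
  fun e => if e == m then w else 0.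

Definition fsum (I : choiceType) (G : Type) (W : zmodType) (F : I -> G -> W) :
    G -> W :=
  fun e => \sum_(i \in [set: I]) F i e.

Definition conv (K : numFieldType) (G : zmodType) (W : lmodType K)
    (a : G -> K^o) (f : G -> W) : G -> W :=
  fun e => \sum_(d \in [set: G]) (a d *: f (e - d)).

Notation "a ** f" := (conv a f) (at level 40, left associativity) : ring_scope.

Definition lower_bounded (W : zmodType) (f : int -> W) : Prop :=
  exists N : int, forall n, n < N -> f n = 0.

(* The inverse in the field K((y)). *)
Definition linv (K : numFieldType) (f : int -> K^o) : int -> K^o :=
  xget (fun=> 0) [set g : int -> K^o |
    lower_bounded g /\ f ** g = mono (0 : int) (1 : K^o)].

Definition lpow (K : numFieldType) (f : int -> K^o) (n : int) : int -> K^o :=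
  match n with
  | Posz k => iter k (conv f) (mono (0 : int) (1 : K^o))
  | Negz k => iter k.+1 (conv (linv f)) (mono (0 : int) (1 : K^o))
  end.

(* e^{s y} *)
Definition lexp (K : numFieldType) (s : rat) (n : int) : K^o :=
  if n is Posz k then ratr s ^+ k / k`!%:R else 0.

(* e^y - 1 *)
Definition lexpm1 (K : numFieldType) (n : int) : K^o :=
  lexp K 1 n - mono (0 : int) (1 : K^o) n.

(* log(1 + t) *)
Definition llog1p (K : numFieldType) (n : int) : K^o :=
  if n is Posz k.+1 then (-1) ^+ k / k.+1%:R else 0.

Definition expo : lmodType rat := (rat^o * rat^o * rat^o)%type.

Definition x0 : expo := (1, 0, 0).
Definition x1 : expo := (0, 1, 0).
Definition x2 : expo := (0, 0, 1).

Definition binr (K : numFieldType) (s : rat) (j : nat) : K :=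
  ratr ((\prod_(i < j) (s - i%:R)) / j`!%:R).

(* (x_i - x_k)^s, expanded in nonnegative integral powers of x_k *)
Definition subpow (K : numFieldType) (i k : expo) (s : rat) : expo -> K^o :=
  fsum (fun j : nat =>
    mono ((s - j%:R) *: i + j%:R *: k) ((-1) ^+ j * binr K s j : K^o)).

(* delta(a ((x_i - x_k) / x_l)^s) *)
Definition delta_sub (K : numFieldType) (a : K) (i k l : expo) (s : rat) :
    expo -> K^o :=
  fsum (fun n : int =>
    mono (- (n%:~R * s) *: l) (a ^ n : K^o) ** subpow K i k (n%:~R * s)).

(* y^n at y = log(1 + x0/x2) *)
Definition ypow (K : numFieldType) (n : int) : expo -> K^o :=
  fsum (fun k : int => mono (k%:~R *: (x0 - x2)) (lpow (@llog1p K) n k)).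

(* \sum_n F_n y^n at y = log(1 + x0/x2) *)
Definition ysubst (K : numFieldType) (W : lmodType K) (F : int -> expo -> W) :
    expo -> W :=
  fsum (fun n : int => ypow K n ** F n).

(* delta(a (e^y x2 / x1)^s) at y = log(1 + x0/x2), with
   (e^y x2 / x1)^{m s} = e^{m s y} x2^{m s} x1^{- m s} *)
Definition delta_exp (K : numFieldType) (a : K) (s : rat) : expo -> K^o :=
  ysubst (W := K^o) (fun n : int => fsum (fun m : int =>
    mono ((m%:~R * s) *: (x2 - x1)) (a ^ m * lexp K (m%:~R * s) n : K^o))).

(* A vertex operator A(x) is encoded as A : rat -> M -> M, with A s the
   coefficient of x^s. *)

(* \sum_(n in (1/p)Z) v_n x^{-n-1}, where Y v k is the mode v_{k/p} *)
Definition vop (V : Type) (M : zmodType) (p : nat) (Y : V -> int -> M -> M)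
    (v : V) (s : rat) (w : M) : M :=
  \sum_(k \in [set: int])
    (if s == - (k%:~R / p%:R) - 1 then Y v k w else 0).

Definition dvop (K : numFieldType) (M : lmodType K) (A : rat -> M -> M)
    (s : rat) (w : M) : M :=
  ratr (s + 1) *: A (s + 1) w.

(* A(x_i) B(x_k) w *)
Definition prod_at (M : zmodType) (i : expo) (A : rat -> M -> M)
    (k : expo) (B : rat -> M -> M) (w : M) : expo -> M :=
  fsum (fun st : rat * rat =>
    mono (st.1 *: i + st.2 *: k) (A st.1 (B st.2 w))).

(* A(x_i) w *)
Definition op_at (M : zmodType) (i : expo) (A : rat -> M -> M) (w : M) :
    expo -> M :=
  fsum (fun s : rat => mono (s *: i) (A s w)).

(* B(A(x0) v, x2) w *)
Definition iter_at (V M : zmodType) (A : rat -> V -> V)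
    (B : V -> rat -> M -> M) (v : V) (w : M) : expo -> M :=
  fsum (fun st : rat * rat =>
    mono (st.1 *: x0 + st.2 *: x2) (B (A st.1 v) st.2 w)).

Definition x0inv (K : numFieldType) : expo -> K^o := mono (- x0) (1 : K^o).
Definition x1inv (K : numFieldType) : expo -> K^o := mono (- x1) (1 : K^o).
Definition x2inv (K : numFieldType) : expo -> K^o := mono (- x2) (1 : K^o).

(* x0^{-1} delta((x1 - x2)/x0) A(x1) B(x2) w
     - x0^{-1} delta((x2 - x1)/(-x0)) B(x2) A(x1) w *)
Definition jacobi_lhs (K : numFieldType) (M : lmodType K)
    (A B : rat -> M -> M) (w : M) : expo -> M :=
  (x0inv K ** delta_sub (1 : K) x1 x2 x0 1) ** prod_at x1 A x2 B w
  - (x0inv K ** delta_sub (-1 : K) x2 x1 x0 1) ** prod_at x2 B x1 A w.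

Definition subspace (K : numFieldType) (V : lmodType K) (S : set V) : Prop :=
  S 0 /\ forall (a : K) (u v : V), S u -> S v -> S (a *: u + v).

Definition fin_dim (K : numFieldType) (V : lmodType K) (S : set V) : Prop :=
  exists (d : nat) (b : 'I_d -> V), (forall i, S (b i)) /\
    forall v, S v -> exists c : 'I_d -> K, v = \sum_(i < d) c i *: b i.

Definition decomposes (K : numFieldType) (I : choiceType) (V : lmodType K)
    (S : I -> set V) (v : V) (f : I -> V) : Prop :=
  [/\ forall i, S i (f i), finite_set [set i | f i <> 0]
    & v = \sum_(i \in [set: I]) f i].

Record is_grading (K : numFieldType) (I : numDomainType) (V : lmodType K)
    (S : I -> set V) : Prop := IsGrading {
  gr_subspace : forall n, subspace (S n);
  gr_direct : forall v, exists! f : I -> V, decomposes S v f;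
  gr_lower : exists N : I, forall n v, n < N -> S n v -> v = 0;
  gr_fin_dim : forall n, fin_dim (S n)
}.

Definition gcomp (K : numFieldType) (I : choiceType) (V : lmodType K)
    (S : I -> set V) (v : V) (n : I) : V :=
  xget (fun=> 0) [set f : I -> V | decomposes S v f] n.

Definition virasoro (K : numFieldType) (M : lmodType K) (c : K)
    (L : int -> M -> M) : Prop :=
  forall (m n : int) (w : M),
    L m (L n w) - L n (L m w) =
      (m - n)%:~R *: L (m + n) w
      + (if m + n == 0 then (c * ((m ^+ 3 - m)%:~R / 12%:R)) *: w else 0).

(* vY v n w is v_n w; thus L(n) = omega_{n+1}, and vcc is the central charge. *)

Record voa (K : numFieldType) := VOA {
  vcar :> lmodType K;
  vgr : int -> set vcar;
  vY : vcar -> int -> vcar -> vcar;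
  vone : vcar;
  vomega : vcar;
  vcc : K;
  vL := fun n : int => vY vomega (n + 1);
  v_grading : is_grading vgr;
  v_linearl : forall n w, linear (fun v => vY v n w);
  v_linearr : forall v n, linear (vY v n);
  v_trunc : forall v w, exists N : int, forall n, N <= n -> vY v n w = 0;
  v_one : forall n w, vY vone n w = if n == -1 then w else 0;
  v_creation : forall v, vY v (-1) vone = v;
  v_creation0 : forall v n, 0 <= n -> vY v n vone = 0;
  v_virasoro : virasoro vcc vL;
  v_L0 : forall n v, vgr n v -> vL 0 v = n%:~R *: v;
  v_deriv : forall u s w, vop 1 vY (vL (-1) u) s w = dvop (vop 1 vY u) s w;
  v_jacobi : forall u v w : vcar,
    jacobi_lhs (vop 1 vY u) (vop 1 vY v) w =
    (x2inv K ** delta_sub (1 : K) x1 x0 x2 1)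
      ** iter_at (vop 1 vY u) (vop 1 vY) v w
}.

Record voa_aut (K : numFieldType) (V : voa K) (nu : V -> V) : Prop := VoaAut {
  aut_linear : linear nu;
  aut_bij : bijective nu;
  aut_one : nu (vone V) = vone V;
  aut_omega : nu (vomega V) = vomega V;
  aut_Y : forall v n w, nu (vY v n w) = vY (nu v) n (nu w)
}.

(* tY v k is the mode v^nu_{k/p}; thus L_M(n) = omega^nu_{n+1} has k = p(n+1). *)
Record twisted_module (K : numFieldType) (V : voa K) (nu : V -> V) (p : nat)
    (omega_p : K) := TwistedModule {
  tcar :> lmodType K;
  tgr : rat -> set tcar;
  tY : V -> int -> tcar -> tcar;
  tL := fun n : int => tY (vomega V) (p%:Z * (n + 1));
  t_grading : is_grading tgr;
  t_linearl : forall k w, linear (fun v => tY v k w);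
  t_linearr : forall v k, linear (tY v k);
  t_trunc : forall v w, exists N : int, forall k, N <= k -> tY v k w = 0;
  t_one : forall k w, tY (vone V) k w = if k == - p%:Z then w else 0;
  t_omega : forall k w, ~~ (p%:Z %| k)%Z -> tY (vomega V) k w = 0;
  t_virasoro : virasoro (vcc V) tL;
  t_L0 : forall n w, tgr n w -> tL 0 w = ratr n *: w;
  t_deriv : forall u s w, vop p tY (vL (-1) u) s w = dvop (vop p tY u) s w;
  t_jacobi : forall (u v : V) (w : tcar),
    jacobi_lhs (vop p tY u) (vop p tY v) w =
    p%:R^-1 *: \sum_(r < p)
      ((x2inv K ** delta_sub (omega_p ^+ r) x1 x0 x2 p%:R^-1)
        ** iter_at (vop 1 (@vY K V) (iter r nu u)) (vop p tY) v w)
}.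

(* X_M(u,x) = Y_M(x^{L(0)} u, x) *)
Definition XM (K : numFieldType) (V : voa K) (nu : V -> V) (p : nat)
    (omega_p : K) (M : twisted_module nu p omega_p)
    (u : V) (s : rat) (w : M) : M :=
  \sum_(n \in [set: int]) vop p (@tY _ _ _ _ _ M) (gcomp (@vgr K V) u n)
                              (s - n%:~R) w.

Arguments XM {K V nu p omega_p} M u s w.

(* Y(a, e^y - 1) v, as a series in y *)
Definition Yexpm1 (K : numFieldType) (V : voa K) (a v : V) (n : int) : V :=
  \sum_(m \in [set: int]) (lpow (@lexpm1 K) (- m - 1) n *: vY a m v).

(* Y[u,y] v = Y(e^{y L(0)} u, e^y - 1) v
            = \sum_k (y^k / k!) Y(L(0)^k u, e^y - 1) v *)
Definition Ybracket (K : numFieldType) (V : voa K) (u v : V) (n : int) : V :=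
  \sum_(k \in [set: nat])
    (k`!%:R^-1 *: Yexpm1 (iter k (@vL K V 0) u) v (n - k%:Z)).

(* Main.v *)
Require Import Defs.
From mathcomp Require Import all_boot all_order all_algebra.
From mathcomp Require Import complex.
From mathcomp Require Import boolp classical_sets functions cardinality fsbigop.
From mathcomp Require Import reals.
From mathcomp Require Import zify ring lra.
Import Order.TTheory GRing.Theory Num.Theory.
Local Open Scope ring_scope.

(** Both sides are additive in [u] and in [v], so [u] and [v] may be taken
    homogeneous, of weights [h] and [h'].

    Then [X_M(u, x) = x^h Y_M(u, x)], so the left side is [x1^h x2^h'] times
    the left side of the twisted Jacobi identity of [Y_M], and that identity
    turns it into a sum over [r] of terms
    [x1^h x2^h' x2^-1 delta(omega_p^r ((x1 - x0) / x2)^(1/p))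
     Y_M(Y(nu^r u, x0) v, x2)].

    On the right side, put [t = x0 / x2] and [y = log (1 + t)].  Substituting
    this [y] is a ring morphism from [K((y))] to [K((t))] which sends [e^{sy}]
    to [(1 + t)^s] and [e^y - 1] to [t] ([logsub_conv], [logsub_lexp],
    [logsub_lpow_lexpm1]).  As [u_m v] has weight [h + h' - m - 1]
    ([vgr_vY]), the series [X_M(Y[u,y]v, x2)] becomes
    [(1 + t)^h x2^(h + h') Y_M(Y(u, x0) v, x2)] ([logsub_XM_Ybracket]); the
    same holds for [nu^r u], which also has weight [h].  The [r]-th terms of
    the two sides then agree by the identity
    [x2^-1 delta(a ((x1 - x0) / x2)^(1/p))
     = x1^-1 delta(a^-1 ((x2 + x0) / x1)^(1/p))] with [a = omega_p^r], next to
    which [x1^h] may be replaced by [(x2 + x0)^h = (1 + t)^h x2^h].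
    On coefficients ([rhs_term_hom]) this amounts to
    [(1 + t)^a (1 + t)^b = (1 + t)^(a + b)] ([binser_conv]) and to
    [binom(- s - 1, n) = (-1)^n binom(s + n, n)] ([binr_negate]).

    All series are compared coefficient by coefficient.  The lemmas
    [jacobi_lhs_int], [iter_term_int] and [exp_term_int] write a coefficient
    as a finitely supported sum over one or two integers, and their
    companions in [_nint] say which coefficients vanish. *)

Set Implicit Arguments.
Unset Strict Implicit.
Unset Printing Implicit Defensive.

(** * Sums of finitely supported families *)

(** [F] vanishes outside a finite list. *)
Definition fsupp (I : choiceType) (W : zmodType) (F : I -> W) : Prop :=
  exists r : seq I, forall i, F i != 0 -> i \in r.

Section Sums.
Variables (W : zmodType).
Implicit Types (I J : choiceType).

(** The prefix [ssum] refers to sums [\sum_(i \in [set: I]) F i]. *)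
Lemma ssum_seq I (r : seq I) (F : I -> W) : uniq r ->
  (forall i, F i != 0 -> i \in r) ->
  \sum_(i \in [set: I]) F i = \sum_(i <- r) F i.
Proof.
move=> ur Fr; rewrite (fsbigE r) //.
  by apply: eq_bigl => i; rewrite in_setT.
move=> i _ ir; apply/eqP; apply: contraNT ir; exact: Fr.
Qed.

Lemma ssum_undup I (r : seq I) (F : I -> W) :
  (forall i, F i != 0 -> i \in r) ->
  \sum_(i \in [set: I]) F i = \sum_(i <- undup r) F i.
Proof.
by move=> Fr; apply: ssum_seq => [|i /Fr]; rewrite ?undup_uniq ?mem_undup.
Qed.

Lemma eq_ssum I (F G : I -> W) : F =1 G ->
  \sum_(i \in [set: I]) F i = \sum_(i \in [set: I]) G i.
Proof. by move=> FG; apply: eq_fsbigr => i _. Qed.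

Lemma ssum0 I (F : I -> W) : (forall i, F i = 0) ->
  \sum_(i \in [set: I]) F i = 0.
Proof. by move=> F0; apply: fsbig1. Qed.

Lemma ssum1 I (i0 : I) (F : I -> W) : (forall i, i != i0 -> F i = 0) ->
  \sum_(i \in [set: I]) F i = F i0.
Proof.
move=> F0; rewrite (ssum_seq (r := [:: i0])) ?big_seq1 // => i.
by rewrite inE; apply: contraR => /F0 ->.
Qed.

Lemma ssumD I (F G : I -> W) : fsupp F -> fsupp G ->
  \sum_(i \in [set: I]) (F i + G i) =
  \sum_(i \in [set: I]) F i + \sum_(i \in [set: I]) G i.
Proof.
move=> [r Fr] [s Gs]; rewrite !(@ssum_undup _ (r ++ s)) ?big_split //.
- by move=> i /Gs; rewrite mem_cat orbC => ->.
- by move=> i /Fr; rewrite mem_cat => ->.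
move=> i; rewrite mem_cat; case: (eqVneq (F i) 0) => [->|/Fr -> //].
by rewrite add0r => /Gs ->; rewrite orbT.
Qed.

Lemma ssum_exchange I J (F : I -> J -> W) :
  fsupp (fun ij : I * J => F ij.1 ij.2) ->
  \sum_(i \in [set: I]) \sum_(j \in [set: J]) F i j =
  \sum_(j \in [set: J]) \sum_(i \in [set: I]) F i j.
Proof.
move=> [r Fr].
have FI i j : F i j != 0 -> i \in map fst r.
  by move=> h; apply/mapP; exists (i, j) => //; apply: Fr.
have FJ i j : F i j != 0 -> j \in map snd r.
  by move=> h; apply/mapP; exists (i, j) => //; apply: Fr.
rewrite [LHS](@ssum_undup _ (map fst r)); last first.
  move=> i; apply: contraR => ni; apply/eqP/ssum0 => j.
  by apply/eqP; apply: contraNT ni => /FI.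
rewrite [RHS](@ssum_undup _ (map snd r)); last first.
  move=> j; apply: contraR => nj; apply/eqP/ssum0 => i.
  by apply/eqP; apply: contraNT nj => /FJ.
rewrite (eq_bigr (fun i => \sum_(j <- undup (map snd r)) F i j)); last first.
  by move=> i _; apply: ssum_undup => j /FJ.
rewrite exchange_big; apply: eq_bigr => j _.
by apply/esym/ssum_undup => i /FI.
Qed.

(** Reindexing along an injection whose image contains the support; no
    finiteness is needed, both sides being [0] for an infinite support. *)
Lemma ssum_reindex I J (h : I -> J) (F : J -> W) : injective h ->
  (forall j, F j != 0 -> exists i, j = h i) ->
  \sum_(j \in [set: J]) F j = \sum_(i \in [set: I]) F (h i).
Proof.
move=> hi Fh; rewrite -(fsbig_image _ h); last by move=> ? ? _ _ /hi.
apply/esym/fsbig_widen => // j [_ nj] /=; apply/eqP.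
by apply: contra_notT nj => /Fh [i ->]; exists i.
Qed.

End Sums.

Lemma ssum_morph (I : choiceType) (W W' : zmodType) (f : W -> W') (F : I -> W) :
  f 0 = 0 -> {morph f : x y / x + y} ->
  fsupp F -> f (\sum_(i \in [set: I]) F i) = \sum_(i \in [set: I]) f (F i).
Proof.
move=> f0 fD [r Fr]; rewrite (ssum_undup Fr) (big_morph f fD f0).
rewrite [RHS](@ssum_undup _ _ r) // => i.
by case: (eqVneq (F i) 0) => [->|/Fr //]; rewrite f0 eqxx.
Qed.

(** Scaling by [a != 0] preserves the support, so that the identity also holds
    for an infinite support. *)
Lemma ssumZ (K : numFieldType) (W : lmodType K) (I : choiceType) (a : K)
    (F : I -> W) :
  a *: (\sum_(i \in [set: I]) F i) = \sum_(i \in [set: I]) (a *: F i).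
Proof.
have [->|a0] := eqVneq a 0.
  by rewrite scale0r ssum0 // => i; rewrite scale0r.
have [[r Fr]|nF] := pselect (fsupp F).
  rewrite (ssum_undup Fr) scaler_sumr [RHS](@ssum_undup _ _ r) // => i.
  by rewrite scaler_eq0 (negPf a0); exact: Fr.
have dflt (G : I -> W) : ~ fsupp G -> \sum_(i \in [set: I]) G i = 0.
  move=> nG; rewrite fsbig_dflt // setTI => /finite_fsetP[X XE]; apply: nG.
  by exists (finmap.enum_fset X) => i /eqP Gi; by move/seteqP: XE => [/(_ i Gi)].
rewrite !dflt ?scaler0 // => -[r ar]; apply: nF; exists r => i Fi.
by apply: ar; rewrite scaler_eq0 negb_or a0.
Qed.

Lemma ssumZl (K : numFieldType) (W : lmodType K) (I : choiceType)
    (F : I -> K^o) (w : W) : fsupp F ->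
  (\sum_(i \in [set: I]) F i) *: w = \sum_(i \in [set: I]) ((F i : K) *: w).
Proof.
move=> [r Fr]; rewrite (ssum_undup Fr) scaler_suml [RHS](@ssum_undup _ _ r) // => i.
by rewrite scaler_eq0 negb_or => /andP[/Fr].
Qed.

Lemma fsupp_sub (I : choiceType) (W W' : zmodType) (F : I -> W) (G : I -> W') :
  fsupp F -> (forall i, F i = 0 -> G i = 0) -> fsupp G.
Proof.
move=> [r Fr] FG; exists r => i Gi; apply: Fr.
by apply: contraNN Gi => /eqP/FG ->.
Qed.

Lemma fsuppD (I : choiceType) (W : zmodType) (F G : I -> W) :
  fsupp F -> fsupp G -> fsupp (fun i => F i + G i).
Proof.
move=> [r Fr] [s Gs]; exists (r ++ s) => i; rewrite mem_cat.
case: (eqVneq (F i) 0) => [->|/Fr -> //].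
by rewrite add0r => /Gs ->; rewrite orbT.
Qed.

(** A list containing the interval [[a, b]]. *)
Definition ibox (a b : int) : seq int :=
  [seq a + i%:Z | i <- iota 0 `|b - a|.+1].

Lemma mem_ibox a b n : a <= n <= b -> n \in ibox a b.
Proof.
move=> /andP[an nb]; apply/mapP; exists `|n - a|%N.
  by rewrite mem_iota; lia.
lia.
Qed.

Lemma fsupp_int (W : zmodType) (F : int -> W) (a b : int) :
  (forall n, F n != 0 -> a <= n <= b) -> fsupp F.
Proof. by move=> Fab; exists (ibox a b) => n /Fab /mem_ibox. Qed.

Lemma fsupp_nat (W : zmodType) (F : nat -> W) (b : nat) :
  (forall n, F n != 0 -> (n <= b)%N) -> fsupp F.
Proof.
by move=> Fb; exists (iota 0 b.+1) => n /Fb nb; rewrite mem_iota.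
Qed.

Lemma fsupp_pair (I J : choiceType) (W : zmodType) (F : I -> J -> W)
    (r : seq I) (s : seq J) :
  (forall i j, F i j != 0 -> i \in r /\ j \in s) ->
  fsupp (fun ij : I * J => F ij.1 ij.2).
Proof.
move=> Frs; exists [seq (i, j) | i <- r, j <- s] => -[i j] /= /Frs[ir js].
by apply/allpairsP; exists (i, j).
Qed.

Lemma ssum_exchange_int (W : zmodType) (F : int -> int -> W) (a b c d : int) :
  (forall i j, F i j != 0 -> a <= i <= b /\ c <= j <= d) ->
  \sum_(i \in [set: int]) \sum_(j \in [set: int]) F i j =
  \sum_(j \in [set: int]) \sum_(i \in [set: int]) F i j.
Proof.
move=> Fb; apply/ssum_exchange/(@fsupp_pair _ _ _ _ (ibox a b) (ibox c d)).
by move=> i j /Fb[ib jb]; split; exact: mem_ibox.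
Qed.

Lemma ssum_shift (W : zmodType) (G : zmodType) (c : G) (F : G -> W) :
  \sum_(n \in [set: G]) F n = \sum_(n \in [set: G]) F (n + c).
Proof.
apply: (ssum_reindex (h := fun n => n + c)); first exact: addIr.
by move=> n _; exists (n - c); rewrite subrK.
Qed.

Lemma ssum_reflect (W : zmodType) (G : zmodType) (c : G) (F : G -> W) :
  \sum_(n \in [set: G]) F n = \sum_(n \in [set: G]) F (c - n).
Proof.
apply: (ssum_reindex (h := fun n => c - n)); first by move=> a b /addrI/oppr_inj.
by move=> n _; exists (c - n); rewrite subKr.
Qed.

Lemma ssum_nat (W : zmodType) (F : nat -> W) (N : nat) :
  (forall i, (N <= i)%N -> F i = 0) ->
  \sum_(i \in [set: nat]) F i = \sum_(i < N) F i.
Proof.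
move=> F0; rewrite (@ssum_seq _ _ (iota 0 N)) ?iota_uniq ?big_mkord //.
  by rewrite -(big_mkord xpredT) /index_iota subn0.
move=> i; rewrite mem_iota /= add0n ltnNge; apply: contraNN => /F0 ->.
by rewrite eqxx.
Qed.

Lemma ssum_posz (W : zmodType) (F : int -> W) :
  (forall n, n < 0 -> F n = 0) ->
  \sum_(n \in [set: int]) F n = \sum_(n \in [set: nat]) F n%:Z.
Proof.
move=> F0; apply: (ssum_reindex (h := Posz)); first by move=> ? ? [].
move=> [n|n] Fn; first by exists n.
by rewrite F0 ?eqxx in Fn.
Qed.

(** * Laurent series *)

(** [f] lies in [y^N K[[y]]]. *)
Definition val_ge (W : zmodType) (N : int) (f : int -> W) : Prop :=
  forall n, n < N -> f n = 0.

Lemma val_geP (W : zmodType) (N : int) (f : int -> W) n :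
  val_ge N f -> f n != 0 -> N <= n.
Proof. by move=> fN; rewrite leNgt; apply: contraNN => /fN ->. Qed.

Lemma conv_mono (K : numFieldType) (G : zmodType) (W : lmodType K) (m : G)
    (a : K^o) (f : G -> W) e : (mono m a ** f) e = a *: f (e - m).
Proof.
rewrite /conv (ssum1 (i0 := m)) /mono ?eqxx // => d /negPf ->.
by rewrite scale0r.
Qed.

Section Laurent.
Variable K : numFieldType.
Implicit Types f g h : int -> K^o.

Let one := mono (0 : int) (1 : K^o).

Lemma conv_supp A B f g e d : val_ge A f -> val_ge B g ->
  f d *: g (e - d) != 0 -> A <= d <= e - B.
Proof.
move=> fA gB; rewrite scaler_eq0 negb_or => /andP[/(val_geP fA) ->].
by move/(val_geP gB); lia.
Qed.

Lemma val_ge_conv A B f g : val_ge A f -> val_ge B g -> val_ge (A + B) (f ** g).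
Proof.
move=> fA gB n nAB; apply: ssum0 => d; apply/eqP; apply: contraTT isT.
by move=> /(conv_supp fA gB); lia.
Qed.

(** [convA] needs bounds, [convC] does not: it only reindexes each sum. *)
Lemma convC f g : f ** g = g ** f.
Proof.
apply/funext => e; rewrite /conv (ssum_reflect e); apply: eq_ssum => d.
by rewrite subKr /GRing.scale /= mulrC.
Qed.

Lemma convA A B C f g h : val_ge A f -> val_ge B g -> val_ge C h ->
  (f ** g) ** h = f ** (g ** h).
Proof.
move=> fA gB hC; apply/funext => e; rewrite /conv.
under eq_ssum => d.
  rewrite ssumZl; last first.
    exact: (@fsupp_int _ _ A (d - B)) (fun c => @conv_supp A B f g d c fA gB).
  over.
rewrite (@ssum_exchange_int _ _ (A + B) (e - C) A (e - C - B)); last first.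
  move=> d c; rewrite !scaler_eq0 !negb_or => /andP[/andP[]].
  by move=> /(val_geP fA) ? /(val_geP gB) ? /(val_geP hC) ?; lia.
apply: eq_ssum => c; rewrite ssumZ (ssum_shift c); apply: eq_ssum => d.
by rewrite scalerA addrK opprD addrA addrAC.
Qed.

Lemma conv1 f : one ** f = f.
Proof. by apply/funext => e; rewrite conv_mono subr0 scale1r. Qed.

Lemma val_ge_mono m (a : K^o) : val_ge m (mono m a).
Proof. by move=> n nm; rewrite /mono lt_eqF. Qed.

(** The coefficients of the inverse of [\sum_i c i y^i] when [c 0 = 1],
    listed up to degree [n]. *)
Fixpoint inv_seq (c : nat -> K) (n : nat) : seq K :=
  if n is n'.+1 then
    let s := inv_seq c n' in
    rcons s (- \sum_(i < n'.+1) c i.+1 * s`_(n' - i)%N)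
  else [:: 1].

(** The coefficient of [y^n] in the inverse of [\sum_i c i y^i]. *)
Definition inv_coef (c : nat -> K) n := (inv_seq c n)`_n.

Lemma size_inv_seq (c : nat -> K) n : size (inv_seq c n) = n.+1.
Proof. by elim: n => //= n IH; rewrite size_rcons IH. Qed.

Lemma inv_seqE (c : nat -> K) n k :
  (k <= n)%N -> (inv_seq c n)`_k = inv_coef c k.
Proof.
elim: n => [|n IH]; first by case: k.
rewrite leq_eqVlt => /orP[/eqP -> //|]; rewrite ltnS => kn.
by rewrite /= nth_rcons size_inv_seq ltnS kn IH.
Qed.

Lemma inv_coefP (c : nat -> K) n : c 0%N = 1 ->
  \sum_(i < n.+1) c i * inv_coef c (n - i)%N = (n == 0%N)%:R.
Proof.
move=> c0; rewrite big_ord_recl c0 mul1r subn0; case: n => [|n].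
  by rewrite big_ord0 addr0.
rewrite {1}/inv_coef /= nth_rcons size_inv_seq ltnn eqxx.
apply/eqP; rewrite addrC subr_eq0; apply/eqP/eq_bigr => i _.
by rewrite /bump /= add1n subSS inv_seqE // leq_subr.
Qed.

(** The inverse of [f = y + O(y^2)]: for [f = y g], it is [y^-1 g^-1]. *)
Definition inv_laurent f (n : int) : K^o :=
  if n + 1 is Posz k then inv_coef (fun i => f i.+1%:Z) k else 0.

Lemma val_ge_inv f : val_ge (-1) (inv_laurent f).
Proof. by move=> n n1; rewrite /inv_laurent; case E: (n + 1) => //; lia. Qed.

Lemma inv_laurentP f : val_ge 1 f -> f 1 = 1 -> f ** inv_laurent f = one.
Proof.
move=> f1 f11; apply/funext => e; case: (ltP e 0) => e0.
  rewrite (val_ge_conv f1 (@val_ge_inv f)) ?subrr //.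
  by rewrite /one (val_ge_mono (m := 0)).
case: e e0 => // n _; rewrite /conv (ssum_shift 1) ssum_posz; last first.
  by move=> m m0; rewrite f1 ?scale0r //; lia.
rewrite (ssum_nat (N := n.+1)); last first.
  by move=> i ni; rewrite (@val_ge_inv f) ?scaler0 //; lia.
transitivity (\sum_(i < n.+1)
    f i.+1%:Z * inv_coef (fun i => f i.+1%:Z) (n - i)%N).
  apply: eq_bigr => i _; rewrite /inv_laurent.
  have -> : n%:Z - (i%:Z + 1) + 1 = (n - i)%N%:Z by have := ltn_ord i; lia.
  by have -> : i%:Z + 1 = i.+1%:Z by lia.
by rewrite (@inv_coefP (fun i => f i.+1%:Z) n f11) /one /mono; case: n.
Qed.

(** Powers of a series [f = y + O(y^2)]. *)
Section Powers.
Variable f : int -> K^o.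
Hypotheses (f1 : val_ge 1 f) (f11 : f 1 = 1).

Lemma linvE : linv f = inv_laurent f.
Proof.
rewrite /linv; case: xgetP => [g _ [[N gN] fg]|/(_ (inv_laurent f)) []]; last first.
  split; last exact: inv_laurentP.
  by exists (-1); exact: val_ge_inv.
have vi := @val_ge_inv f.
rewrite -[g]conv1 -/one -(inv_laurentP f1 f11) [f ** _]convC.
by rewrite (convA vi f1 gN) fg convC conv1.
Qed.

Lemma val_ge_linv : val_ge (-1) (linv f).
Proof. by rewrite linvE; exact: val_ge_inv. Qed.

Lemma conv_linv : f ** linv f = one.
Proof. by rewrite linvE inv_laurentP. Qed.

Lemma val_ge_lpow n : val_ge n (lpow f n).
Proof.
case: n => n; elim: n => [|n IH]; rewrite /lpow ?iterS.
- exact: val_ge_mono.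
- by move: (val_ge_conv f1 IH); rewrite intS.
- by move: (val_ge_conv val_ge_linv (@val_ge_mono 0 1)); rewrite addr0.
- move: (val_ge_conv val_ge_linv IH).
  by have -> : -1 + Negz n = Negz n.+1 by rewrite !NegzE; lia.
Qed.

Lemma lpowS n : lpow f (n + 1) = f ** lpow f n.
Proof.
case: n => [n|[|n]]; first by rewrite addrC -intS.
  by rewrite /= (convC (linv f)) conv1 conv_linv.
have -> : Negz n.+1 + 1 = Negz n by rewrite !NegzE; lia.
rewrite /(lpow f (Negz n.+1)) iterS -/(lpow f (Negz n)).
by rewrite -(convA f1 val_ge_linv (@val_ge_lpow (Negz n))) conv_linv conv1.
Qed.

Lemma lpowD m n : lpow f (m + n) = lpow f m ** lpow f n.
Proof.
elim: m => [|m IH|m IH]; first by rewrite add0r /lpow /= conv1.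
  rewrite intS [1 + _]addrC addrAC !lpowS IH.
  by rewrite -(convA f1 (@val_ge_lpow _) (@val_ge_lpow _)).
have step k : lpow f (k - 1) = linv f ** lpow f k.
  rewrite -{2}[k](subrK 1) lpowS -(convA val_ge_linv f1 (@val_ge_lpow _)).
  by rewrite (convC (linv f)) conv_linv conv1.
rewrite intS opprD [-1 + _]addrC addrAC !step IH.
by rewrite -(convA val_ge_linv (@val_ge_lpow _) (@val_ge_lpow _)).
Qed.

End Powers.
End Laurent.

(** * The substitution y = log(1 + t) *)

Section LogSubst.
Variable K : numFieldType.
Implicit Types f g : int -> K^o.

(** The binomial series [(1 + t)^s]. *)
Definition binser (s : rat) (n : int) : K^o :=
  if n is Posz k then binr K s k else 0.

Lemma val_ge_binser s : val_ge 0 (binser s).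
Proof. by case. Qed.

Lemma binr0 s : binr K s 0 = 1.
Proof. by rewrite /binr big_ord0 divr1 rmorph1. Qed.

Lemma binrS s k : k.+1%:R * binr K s k.+1 = (ratr s - k%:R) * binr K s k.
Proof.
rewrite /binr big_ord_recr /= factS natrM invfM.
rewrite !rmorphM rmorphB !fmorphV /= !ratr_nat.
set P := ratr _; have k0 : k.+1%:R != 0 :> K by rewrite pnatr_eq0.
have f0 : k`!%:R != 0 :> K by rewrite pnatr_eq0 -lt0n fact_gt0.
by move: (k.+1%:R) (k`!%:R) k0 f0 => a b a0 b0; field; rewrite ?a0 ?b0.
Qed.

Lemma binr_small (k j : nat) : (k < j)%N -> binr K k%:R j = 0.
Proof.
move=> kj; rewrite /binr (bigD1 (Ordinal kj)) //= subrr !mul0r; exact: rmorph0.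
Qed.

(** The derivation [(1 + t) d/dt]. *)
Definition der1p f (n : int) : K^o := (n + 1)%:~R * f (n + 1) + n%:~R * f n.

Lemma der1p_conv A B f g : val_ge A f -> val_ge B g ->
  der1p (f ** g) = (fun n => (der1p f ** g) n + (f ** der1p g) n).
Proof.
move=> fA gB; apply/funext => e.
have F (a : int -> K) m : fsupp (fun d => a d * (f d * g (m - d)) : K^o).
  apply: (@fsupp_int _ _ A (m - B)) => d; rewrite mulf_eq0 negb_or.
  by move=> /andP[_ /(conv_supp fA gB)].
pose T (a : int -> K) m : K^o := \sum_(d \in [set: int]) (a d * (f d * g (m - d))).
transitivity (T intr (e + 1) + T (fun d => (e + 1 - d)%:~R) (e + 1)
  + (T intr e + T (fun d => (e - d)%:~R) e)).
  rewrite /der1p /conv /T; congr (_ + _).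
    rewrite -ssumD // -[LHS]/(_ *: _) ssumZ; apply: eq_ssum => d.
    by rewrite /GRing.scale /= -mulrDl -rmorphD; congr (_%:~R * _); lia.
  rewrite -ssumD // -[LHS]/(_ *: _) ssumZ; apply: eq_ssum => d.
  by rewrite /GRing.scale /= -mulrDl -rmorphD; congr (_%:~R * _); lia.
rewrite addrACA; congr (_ + _).
  rewrite [T _ (e + 1)]/T (ssum_shift 1) /T /conv -ssumD //; last first.
    apply: (@fsupp_int _ _ (A - 1) (e - B)) => d.
    by rewrite mulf_eq0 negb_or => /andP[_ /(conv_supp fA gB)]; lia.
  apply: eq_ssum => d; rewrite /der1p /GRing.scale /= mulrDl !mulrA.
  by congr (_ * g _ + _); lia.
rewrite /T -ssumD // /conv; apply: eq_ssum => d.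
rewrite /der1p /GRing.scale /= mulrDr !(mulrCA (f d)).
by congr (_%:~R * (_ * g _) + _); lia.
Qed.

(** A solution of [(1 + t) f' = s f] is determined by its constant term. *)
Lemma binser_unique s f : val_ge 0 f -> f 0 = 1 ->
  (forall n, der1p f n = ratr s * f n) -> f = binser s.
Proof.
move=> f0 f1 fD; apply/funext; case=> [n|n]; last by rewrite f0.
elim: n => [|n IH]; first by rewrite f1 /= binr0.
have n0 : n.+1%:R != 0 :> K by rewrite pnatr_eq0.
apply: (mulfI n0); rewrite /= binrS -[binr _ _ _]/(binser s n) -IH.
rewrite mulrBl -fD /der1p -[n%:R]/(n%:~R) addrK.
by have -> : n%:Z + 1 = n.+1%:Z by lia.
Qed.

Lemma der1p_binser s n : der1p (binser s) n = ratr s * binser s n.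
Proof.
rewrite /der1p; case: n => [n|[|n]].
- have -> : n%:Z + 1 = n.+1%:Z by lia.
  by rewrite -!pmulrn [LHS]/= binrS mulrBl subrK.
- by rewrite /= mul0r !mulr0 addr0.
- have -> : Negz n.+1 + 1 = Negz n by rewrite !NegzE; lia.
  by rewrite !mulr0 addr0.
Qed.

Lemma binser_conv a b : binser a ** binser b = binser (a + b).
Proof.
have va := @val_ge_binser a; have vb := @val_ge_binser b.
apply: binser_unique.
- by move: (val_ge_conv va vb); rewrite addr0.
- rewrite /conv (ssum1 (i0 := 0)); first by rewrite subr0 /= !binr0 scale1r.
  by case=> [[|n]|n] // _; rewrite ?scale0r // sub0r scaler0.
move=> n; rewrite (der1p_conv va vb) rmorphD mulrDl; congr (_ + _).
  rewrite -[RHS]/(_ *: _) /conv ssumZ; apply: eq_ssum => d.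
  by rewrite der1p_binser scalerA.
rewrite -[RHS]/(_ *: _) /conv ssumZ; apply: eq_ssum => d.
by rewrite der1p_binser !scalerA mulrC -scalerA.
Qed.

Let L := @llog1p K.

Lemma val_ge_llog1p : val_ge 1 L.
Proof. by case=> [[|n]|n]. Qed.

Lemma llog1p1 : L 1 = 1.
Proof. by rewrite -[L 1]/((-1) ^+ 0 / 1%:R : K) expr0 mul1r invr1. Qed.

Lemma der1p_llog1p : der1p L = mono (0 : int) (1 : K^o).
Proof.
have LE (k : nat) : k.+1%:Z%:~R * L k.+1%:Z = (-1) ^+ k.
  by rewrite mulrCA divff ?mulr1 // pnatr_eq0.
apply/funext; case=> [[|n]|n]; rewrite /der1p.
- by rewrite add0r (LE 0%N) mul0r addr0.
- have -> : n.+1%:Z + 1 = n.+2%:Z by lia.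
  by rewrite !LE exprS mulN1r addNr.
- have -> : L (Negz n + 1) = 0.
    by apply: val_ge_llog1p; rewrite NegzE; lia.
  by rewrite !mulr0 addr0.
Qed.

(** [(log (1 + t))^n] *)
Definition logpow := lpow L.

Lemma val_ge_logpow n : val_ge n (logpow n).
Proof. exact: val_ge_lpow val_ge_llog1p llog1p1 n. Qed.

Lemma logpowD m n : logpow (m + n) = logpow m ** logpow n.
Proof. exact: lpowD val_ge_llog1p llog1p1 m n. Qed.

Lemma der1p_logpow (n : nat) k :
  der1p (logpow n.+1) k = n.+1%:R * logpow n k.
Proof.
elim: n k => [|n IH] k.
  by rewrite -[logpow 1]/(L ** logpow 0) convC conv1 der1p_llog1p mul1r.
rewrite -[logpow n.+2]/(L ** logpow n.+1).
rewrite (der1p_conv val_ge_llog1p (@val_ge_logpow _)) der1p_llog1p conv1.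
rewrite -[in RHS]natr1 mulrDl mul1r addrC; congr (_ + _).
rewrite -[RHS]/(_ *: _) -[logpow n.+1]/(L ** logpow n) /conv ssumZ.
by apply: eq_ssum => d; rewrite IH !scalerA mulrC -scalerA.
Qed.

(** [f (log (1 + t))] *)
Definition logsub f (k : int) : K^o :=
  \sum_(n \in [set: int]) (f n *: logpow n k).

Lemma logsub_supp A f n k : val_ge A f -> f n *: logpow n k != 0 -> A <= n <= k.
Proof.
move=> fA; rewrite scaler_eq0 negb_or => /andP[/(val_geP fA) ->].
exact/val_geP/val_ge_logpow.
Qed.

Lemma val_ge_logsub A f : val_ge A f -> val_ge A (logsub f).
Proof.
move=> fA k kA; apply: ssum0 => n; apply/eqP; apply: contraTT isT.
by move/(logsub_supp fA); lia.
Qed.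

Lemma logsub1 : logsub (mono (0 : int) (1 : K^o)) = mono (0 : int) (1 : K^o).
Proof.
apply/funext => k; rewrite /logsub (ssum1 (i0 := 0)) /mono ?eqxx ?scale1r //.
by move=> n /negPf ->; rewrite scale0r.
Qed.

Lemma logsubB A f g : val_ge A f -> val_ge A g ->
  logsub (fun n => f n - g n) = (fun n => logsub f n - logsub g n).
Proof.
move=> fA gA; apply/funext => k.
have supp h : val_ge A h -> fsupp (fun n => h n *: logpow n k : K^o).
  by move=> hA; apply: (@fsupp_int _ _ A k) => n; exact: logsub_supp.
rewrite /logsub -[X in _ = _ + X]scaleN1r ssumZ -ssumD; first last.
- by apply: fsupp_sub (supp _ gA) _ => n ->; rewrite scaler0.
- exact: supp.
by apply: eq_ssum => n; rewrite scalerBl scaleN1r.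
Qed.

(** The substitution is multiplicative. *)
Lemma logsub_conv A B f g : val_ge A f -> val_ge B g ->
  logsub (f ** g) = logsub f ** logsub g.
Proof.
move=> fA gB; apply/funext => k; pose W : zmodType := K^o.
pose T d n c : W := (f d * logpow d c) * (g n * logpow n (k - c)).
have Tb d n c : T d n c != 0 -> [/\ A <= d <= c, B <= n & n <= k - c].
  rewrite mulf_eq0 negb_or => /andP[].
  by move=> /(logsub_supp fA) -> /(logsub_supp gB)/andP[-> ->].
transitivity (\sum_(d \in [set: int]) \sum_(n \in [set: int])
                \sum_(c \in [set: int]) T d n c).
  transitivity (\sum_(n \in [set: int]) \sum_(d \in [set: int])
                  ((f d * g (n - d)) *: logpow n k : K^o)).
    apply: eq_ssum => n; rewrite /conv ssumZl //.
    exact: (@fsupp_int _ _ A (n - B)) (fun d => @conv_supp _ A B f g n d fA gB).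
  rewrite (@ssum_exchange_int _ _ (A + B) k A (k - B)); last first.
    move=> n d; rewrite scaler_eq0 mulf_eq0 !negb_or => /andP[/andP[]].
    by move=> /(val_geP fA) ? /(val_geP gB) ? /(val_geP (@val_ge_logpow _)) ?; lia.
  apply: eq_ssum => d; rewrite (ssum_shift d); apply: eq_ssum => n.
  rewrite addrK addrC logpowD {1}/conv ssumZ; apply: eq_ssum => c.
  by rewrite /T /GRing.scale /=; ring.
transitivity (\sum_(d \in [set: int]) \sum_(c \in [set: int])
                \sum_(n \in [set: int]) T d n c).
  apply: eq_ssum => d.
  apply: (@ssum_exchange_int _ _ B (k - A) A (k - B)) => n c /Tb[]; lia.
rewrite (@ssum_exchange_int _ _ A (k - B) A (k - B)); last first.
  move=> d c nz; suff [n] : exists n, T d n c != 0 by move=> /Tb[]; lia.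
  apply: contrapT => none; move/eqP: nz; apply; apply: ssum0 => n.
  by apply/eqP; apply: contra_notT none => nz; exists n.
rewrite /conv; apply: eq_ssum => c; rewrite {1}/logsub ssumZl; last first.
  by apply: (@fsupp_int _ _ A c) => d; exact: logsub_supp.
by apply: eq_ssum => d; rewrite /logsub ssumZ.
Qed.

(** [e^{s log (1 + t)} = (1 + t)^s] *)
Lemma logsub_lexp s : logsub (lexp K s) = binser s.
Proof.
have l0 : val_ge 0 (lexp K s) by case.
apply: binser_unique; first exact: val_ge_logsub.
  rewrite /logsub (ssum1 (i0 := 0)) => [|n n0].
    by rewrite /logpow /= /mono eqxx expr0 invr1 mulr1 scale1r.
  apply/eqP; apply: contraTT n0 => /(logsub_supp l0) n0; lia.
move=> k; rewrite /der1p.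
(* Termwise, [(1 + t) d/dt] maps [s^n/n! log(1+t)^n] to
   [s^n/(n-1)! log(1+t)^(n-1)], that is, to [s] times the previous term. *)
have e k' : logsub (lexp K s) k' =
    \sum_(n \in [set: nat]) (lexp K s n%:Z *: logpow n%:Z k' : K^o).
  by apply: ssum_posz => n n0; rewrite l0 // scale0r.
have supp k' : fsupp (fun n : nat => lexp K s n *: logpow n k' : K^o).
  by apply: (@fsupp_nat _ _ `|k'|%N) => n /(logsub_supp l0); lia.
rewrite !e -[LHS]/(_ *: _ + _ *: _) !ssumZ -ssumD; first last.
- by apply: fsupp_sub (supp k) _ => n ->; rewrite scaler0.
- by apply: fsupp_sub (supp (k + 1)) _ => n ->; rewrite scaler0.
rewrite -[RHS]/(_ *: _) !ssumZ.
pose G (n : nat) : K^o := if n is n'.+1 then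
  lexp K s n *: (n%:R * logpow n' k) else 0.
transitivity (\sum_(n \in [set: nat]) G n).
  apply: eq_ssum => n.
  transitivity (lexp K s n *: der1p (logpow n) k : K^o).
    by rewrite /der1p /GRing.scale /=; ring.
  case: n => [|n]; last by rewrite der1p_logpow.
  rewrite /G; suff -> : der1p (logpow 0) k = 0 by rewrite scaler0.
  rewrite /der1p /logpow /= /mono; case: eqVneq => [->|_].
    by rewrite mul0r add0r; case: eqVneq => [->|_]; rewrite ?mul0r ?mulr0.
  by rewrite mulr0 add0r; case: eqVneq => [->|_]; rewrite ?mul0r ?mulr0.
rewrite (ssum_reindex (h := S)) => [||[|n]]; first 1 last.
- by move=> ? ? [].
- by rewrite eqxx.
- by exists n.
apply: eq_ssum => n; rewrite /GRing.scale /= exprS factS natrM.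
have n0 : n.+1%:R != 0 :> K by rewrite pnatr_eq0.
have f0 : n`!%:R != 0 :> K by rewrite pnatr_eq0 -lt0n fact_gt0.
move: (n.+1%:R) (n`!%:R) n0 f0 => a b a0 b0.
by rewrite -[LHS]/(_ * _ : K); field; rewrite a0 b0.
Qed.

Let E := @lexpm1 K.

Lemma val_ge_lexpm1 : val_ge 1 E.
Proof.
case=> [[|n]|n] // _; rewrite /E /lexpm1 /mono /=.
  by rewrite expr0 invr1 mulr1 subrr.
by rewrite subr0.
Qed.

Lemma lexpm11 : E 1 = 1.
Proof.
rewrite -[E 1]/(ratr 1 ^+ 1 / 1`!%:R - 0 : K).
by rewrite rmorph1 divr1 subr0.
Qed.

(** [e^{log (1 + t)} - 1 = t] *)
Lemma logsub_lexpm1 : logsub E = mono (1 : int) (1 : K^o).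
Proof.
have l0 : val_ge 0 (lexp K 1) by case.
rewrite /E (logsubB l0 (@val_ge_mono _ 0 1)) logsub1 logsub_lexp.
apply/funext; case=> [[|[|n]]|n]; rewrite /mono /=.
- by rewrite binr0 subrr.
- by rewrite subr0 /binr big_ord1 subr0 divr1 rmorph1.
- by rewrite subr0 /binr !big_ord_recl /= subrr mul0r mulr0 mul0r rmorph0.
- by rewrite subr0.
Qed.

Lemma val_ge_lpow_lexpm1 m : val_ge m (lpow E m).
Proof. exact: val_ge_lpow val_ge_lexpm1 lexpm11 m. Qed.

Lemma logsub_lpow_lexpm1 m : logsub (lpow E m) = mono m (1 : K^o).
Proof.
have step n k : logsub (lpow E (n + 1)) (k + 1) = logsub (lpow E n) k.
  rewrite (lpowS val_ge_lexpm1 lexpm11).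
  rewrite (logsub_conv val_ge_lexpm1 (@val_ge_lpow_lexpm1 _)).
  by rewrite logsub_lexpm1 conv_mono addrK scale1r.
(* [step] moves the power both up and down, hence covers negative [m]. *)
apply/funext; elim: m => [|m IH|m IH] k; first by rewrite logsub1.
  rewrite -[k](subrK 1) intS addrC step IH /mono.
  by congr (if _ then _ else _); lia.
rewrite -step; have -> : - m.+1%:Z + 1 = - m%:Z by lia.
rewrite IH /mono.
by congr (if _ then _ else _); lia.
Qed.

(** [e^{s y} (e^y - 1)^m] becomes [(1 + t)^s t^m]. *)
Lemma logsub_exp_lpow s m k :
  logsub (lexp K s ** lpow (@lexpm1 K) m) k = binser s (k - m).
Proof.
have l0 : val_ge 0 (lexp K s) by case.
rewrite (logsub_conv l0 (@val_ge_lpow_lexpm1 m)).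
by rewrite logsub_lpow_lexpm1 logsub_lexp convC conv_mono scale1r.
Qed.

Lemma val_ge_exp_lpow s m : val_ge m (lexp K s ** lpow (@lexpm1 K) m).
Proof.
have l0 : val_ge 0 (lexp K s) by case.
by have := val_ge_conv l0 (@val_ge_lpow_lexpm1 m); rewrite add0r.
Qed.

(** [binom(- s - 1, n) = (-1)^n binom(s + n, n)] *)
Lemma binr_negate s n :
  binr K (- s - 1) n = (-1) ^+ n * binr K (s + n%:R) n.
Proof.
rewrite /binr (reindex_inj rev_ord_inj) /=.
transitivity (ratr ((-1) ^+ n * ((\prod_(i < n) (s + n%:R - i%:R)) / n`!%:R)) : K).
  congr ratr; rewrite mulrA; congr (_ / _).
  transitivity (\prod_(i < n) - (s + n%:R - i%:R)); last by rewrite prodrN card_ord.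
  apply: eq_bigr => i _; rewrite natrB ?ltn_ord // -natr1.
  by ring.
by rewrite rmorphM rmorphXn rmorphN1.
Qed.

End LogSubst.

(** * Coefficients of series in x0, x1, x2 *)

(** The exponents of [x0], [x1] and [x2] in a monomial. *)
Definition ex0 (e : expo) : rat := e.1.1.
Definition ex1 (e : expo) : rat := e.1.2.
Definition ex2 (e : expo) : rat := e.2.

Arguments ex0 : simpl never.
Arguments ex1 : simpl never.
Arguments ex2 : simpl never.

Lemma expoP (e e' : expo) :
  ex0 e = ex0 e' -> ex1 e = ex1 e' -> ex2 e = ex2 e' -> e = e'.
Proof.
by case: e e' => [[a b] c] [[a' b'] c']; rewrite /ex0 /ex1 /ex2 /= => -> -> ->.
Qed.

Lemma ex0D e e' : ex0 (e + e') = ex0 e + ex0 e'. Proof. by []. Qed.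
Lemma ex1D e e' : ex1 (e + e') = ex1 e + ex1 e'. Proof. by []. Qed.
Lemma ex2D e e' : ex2 (e + e') = ex2 e + ex2 e'. Proof. by []. Qed.
Lemma ex0N e : ex0 (- e) = - ex0 e. Proof. by []. Qed.
Lemma ex1N e : ex1 (- e) = - ex1 e. Proof. by []. Qed.
Lemma ex2N e : ex2 (- e) = - ex2 e. Proof. by []. Qed.
Lemma ex0Z a e : ex0 (a *: e) = a * ex0 e. Proof. by []. Qed.
Lemma ex1Z a e : ex1 (a *: e) = a * ex1 e. Proof. by []. Qed.
Lemma ex2Z a e : ex2 (a *: e) = a * ex2 e. Proof. by []. Qed.
Lemma ex_x0 : (ex0 x0 = 1) * (ex1 x0 = 0) * (ex2 x0 = 0). Proof. by []. Qed.
Lemma ex_x1 : (ex0 x1 = 0) * (ex1 x1 = 1) * (ex2 x1 = 0). Proof. by []. Qed.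
Lemma ex_x2 : (ex0 x2 = 0) * (ex1 x2 = 0) * (ex2 x2 = 1). Proof. by []. Qed.

(** Rewrite rules computing exponents. *)
Definition exE :=
  (ex0D, ex1D, ex2D, ex0N, ex1N, ex2N, ex0Z, ex1Z, ex2Z, ex_x0, ex_x1, ex_x2,
   (mulr0, mulr1, addr0, add0r, oppr0, subr0)).

Section MonoSums.
Variables (K : numFieldType) (G : zmodType).

Lemma fsum_mono (I : choiceType) (W : zmodType) (i : I -> G) (c : I -> W) k :
  injective i -> fsum (fun k => mono (i k) (c k)) (i k) = c k.
Proof.
move=> ii; rewrite /fsum (ssum1 (i0 := k)) /mono ?eqxx // => l lk.
by rewrite (inj_eq ii) eq_sym (negPf lk).
Qed.

Lemma fsum_mono0 (I : choiceType) (W : zmodType) (i : I -> G) (c : I -> W) e :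
  (forall k, e <> i k) -> fsum (fun k => mono (i k) (c k)) e = 0.
Proof. by move=> ei; apply: ssum0 => k; rewrite /mono; case: eqP => // /ei. Qed.

Lemma fsum_mono_supp (I : choiceType) (W : zmodType) (i : I -> G) (c : I -> W) e :
  fsum (fun k => mono (i k) (c k)) e != 0 -> exists k, e = i k.
Proof.
move=> nz; apply: contrapT => none; move/eqP: nz; apply; apply: fsum_mono0 => k ek.
by apply: none; exists k.
Qed.

(** A product whose left factor has distinct monomials [i k]. *)
Lemma conv_fsum_mono (I : choiceType) (W : lmodType K) (i : I -> G)
    (c : I -> K^o) (f : G -> W) e : injective i ->
  (fsum (fun k => mono (i k) (c k)) ** f) e =
  \sum_(k \in [set: I]) (c k *: f (e - i k)).
Proof.
move=> ii; rewrite /conv (ssum_reindex ii).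
  by apply: eq_ssum => k; rewrite fsum_mono.
by move=> d; rewrite scaler_eq0 negb_or => /andP[/fsum_mono_supp].
Qed.

(** Merges an iterated sum of distinct monomials. *)
Lemma fsum_pair (I J : choiceType) (W : zmodType) (i : I * J -> G)
    (c : I * J -> W) : injective i ->
  fsum (fun k => fsum (fun l => mono (i (k, l)) (c (k, l)))) =
  fsum (fun kl => mono (i kl) (c kl)).
Proof.
move=> ii; apply/funext => e.
have [[[k l] ->]|none] := pselect (exists kl, e = i kl).
  rewrite fsum_mono // /fsum (ssum1 (i0 := k)) ?(ssum1 (i0 := l)).
  - by rewrite /mono eqxx.
  - by move=> l' ll'; rewrite /mono (inj_eq ii) xpair_eqE [l == _]eq_sym (negPf ll') andbF.
  - move=> k' kk'; apply: ssum0 => l'.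
    by rewrite /mono (inj_eq ii) xpair_eqE [k == _]eq_sym (negPf kk').
rewrite fsum_mono0 => [|kl ekl]; last by apply: none; exists kl.
apply: ssum0 => k; apply: fsum_mono0 => l ekl.
by apply: none; exists (k, l).
Qed.

Lemma conv_mono_conv (W : lmodType K) (m : G) (f : G -> K^o) (g : G -> W) e :
  ((mono m (1 : K^o) ** f) ** g) e = (f ** g) (e - m).
Proof.
rewrite {1}/conv (ssum_shift m); apply: eq_ssum => d.
by rewrite conv_mono scale1r addrK opprD addrA addrAC.
Qed.

End MonoSums.

Section Coefficients.
Variable K : numFieldType.

(* Splits an equation between exponents into its three components. *)
Ltac exinj E := (have := congr1 ex0 E; have := congr1 ex1 E;
  have := congr1 ex2 E; rewrite ?exE).

Lemma prod_at12E (M : zmodType) (A B : rat -> M -> M) (w : M) e :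
  prod_at x1 A x2 B w e = if ex0 e == 0 then A (ex1 e) (B (ex2 e) w) else 0.
Proof.
case: ifP => [/eqP e0|/negP e0]; last first.
  by apply: fsum_mono0 => st E; apply: e0; rewrite E !exE.
have {1}-> : e = ex1 e *: x1 + ex2 e *: x2 by apply: expoP; rewrite !exE.
apply: (@fsum_mono _ _ _ (fun st => st.1 *: x1 + st.2 *: x2)
  (fun st => A st.1 (B st.2 w)) (ex1 e, ex2 e)).
by move=> [a b] [a' b'] /= E; exinj E => -> ->.
Qed.

Lemma prod_at21E (M : zmodType) (A B : rat -> M -> M) (w : M) e :
  prod_at x2 B x1 A w e = if ex0 e == 0 then B (ex2 e) (A (ex1 e) w) else 0.
Proof.
case: ifP => [/eqP e0|/negP e0]; last first.
  by apply: fsum_mono0 => st E; apply: e0; rewrite E !exE.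
have {1}-> : e = ex2 e *: x2 + ex1 e *: x1 by apply: expoP; rewrite !exE.
apply: (@fsum_mono _ _ _ (fun st => st.1 *: x2 + st.2 *: x1)
  (fun st => B st.1 (A st.2 w)) (ex2 e, ex1 e)).
by move=> [a b] [a' b'] /= E; exinj E => -> ->.
Qed.

Lemma op_at2E (M : zmodType) (A : rat -> M -> M) (w : M) e :
  op_at x2 A w e = if (ex0 e == 0) && (ex1 e == 0) then A (ex2 e) w else 0.
Proof.
case: ifP => [/andP[/eqP e0 /eqP e1]|/negP e01]; last first.
  by apply: fsum_mono0 => s E; apply: e01; rewrite E !exE.
have {1}-> : e = ex2 e *: x2 by apply: expoP; rewrite !exE.
apply: (@fsum_mono _ _ _ (fun s => s *: x2) (fun s => A s w) (ex2 e)).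
by move=> a b E; exinj E.
Qed.

Lemma iter_atE (V M : zmodType) (A : rat -> V -> V) (B : V -> rat -> M -> M)
    (v : V) (w : M) e :
  iter_at A B v w e = if ex1 e == 0 then B (A (ex0 e) v) (ex2 e) w else 0.
Proof.
case: ifP => [/eqP e0|/negP e0]; last first.
  by apply: fsum_mono0 => st E; apply: e0; rewrite E !exE.
have {1}-> : e = ex0 e *: x0 + ex2 e *: x2 by apply: expoP; rewrite !exE.
apply: (@fsum_mono _ _ _ (fun st => st.1 *: x0 + st.2 *: x2)
  (fun st => B (A st.1 v) st.2 w) (ex0 e, ex2 e)).
by move=> [a b] [a' b'] /= E; exinj E => -> _ ->.
Qed.

(** [delta (a ((x_i - x_k) / x_l)^s)] as a series indexed by the power [n] of
    its argument and the power [j] of [x_k]. *)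
Lemma delta_subE (a : K) (i k l : expo) (s : rat) :
  injective (fun nj : int * nat =>
    (nj.1%:~R * s - nj.2%:R) *: i + nj.2%:R *: k - (nj.1%:~R * s) *: l) ->
  delta_sub a i k l s =
  fsum (fun nj : int * nat =>
    mono ((nj.1%:~R * s - nj.2%:R) *: i + nj.2%:R *: k - (nj.1%:~R * s) *: l)
      (a ^ nj.1 * ((-1) ^+ nj.2 * binr K (nj.1%:~R * s) nj.2) : K^o)).
Proof.
move=> ii; rewrite -[RHS](@fsum_pair _ _ _ _
  (fun nj => (nj.1%:~R * s - nj.2%:R) *: i + nj.2%:R *: k - (nj.1%:~R * s) *: l)
  (fun nj => a ^ nj.1 * ((-1) ^+ nj.2 * binr K (nj.1%:~R * s) nj.2) : K^o)) //.
apply/funext => e; apply: eq_ssum => n; rewrite conv_mono /subpow /fsum ssumZ.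
apply: eq_ssum => j /=; rewrite /mono scaleNr opprK [e == _]eq_sym subr_eq [_ == e + _]eq_sym.
by case: ifP => // _; rewrite scaler0.
Qed.

Lemma natr_inj : injective (fun j : nat => j%:R : rat).
Proof. by move=> i j /eqP; rewrite eqr_nat => /eqP. Qed.

Section JacobiLhs.

Lemma delta12_inj : injective (fun nj : int * nat =>
  (nj.1%:~R * 1 - nj.2%:R) *: x1 + nj.2%:R *: x2 - (nj.1%:~R * 1) *: x0).
Proof.
by move=> [m j] [m' j'] /= E; exinj E => /natr_inj -> _ /oppr_inj/intr_inj ->.
Qed.

Lemma delta21_inj : injective (fun nj : int * nat =>
  (nj.1%:~R * 1 - nj.2%:R) *: x2 + nj.2%:R *: x1 - (nj.1%:~R * 1) *: x0).
Proof.
by move=> [m j] [m' j'] /= E; exinj E => _ /natr_inj -> /oppr_inj/intr_inj ->.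
Qed.

Variables (M : lmodType K) (A B : rat -> M -> M) (w : M).

(** As [x0] occurs in the delta series only through [x0^(- n - 1)], the exponent
    of [x0] determines [n]. *)
Lemma jacobi_term1 (n : int) e : ex0 e = - n%:~R - 1 ->
  ((x0inv K ** delta_sub (1 : K) x1 x2 x0 1) ** prod_at x1 A x2 B w) e =
  \sum_(j \in [set: nat]) (((-1) ^+ j * binr K n%:~R j)
     *: A (ex1 e - n%:~R + j%:R) (B (ex2 e - j%:R) w)).
Proof.
move=> en; rewrite conv_mono_conv (delta_subE _ delta12_inj).
rewrite (conv_fsum_mono _ _ _ delta12_inj).
rewrite (ssum_reindex (h := fun j : nat => (n, j))); first last.
- move=> [m j]; rewrite scaler_eq0 negb_or => /andP[_]; rewrite prod_at12E /= !exE.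
  case: ifP; rewrite ?eqxx // => /eqP; rewrite en => E _; exists j; congr pair.
  by apply: (@intr_inj rat); move: E; lra.
- by move=> j j' [].
apply: eq_ssum => j /=; rewrite exp1rz mul1r mulr1; congr (_ *: _).
rewrite prod_at12E !exE en; case: eqP => [_|[]]; last by lra.
by congr (A _ (B _ w)); lra.
Qed.

Lemma jacobi_term2 (n : int) e : ex0 e = - n%:~R - 1 ->
  ((x0inv K ** delta_sub (-1 : K) x2 x1 x0 1) ** prod_at x2 B x1 A w) e =
  \sum_(j \in [set: nat]) (((-1) ^ n * ((-1) ^+ j * binr K n%:~R j))
     *: B (ex2 e - n%:~R + j%:R) (A (ex1 e - j%:R) w)).
Proof.
move=> en; rewrite conv_mono_conv (delta_subE _ delta21_inj).
rewrite (conv_fsum_mono _ _ _ delta21_inj).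
rewrite (ssum_reindex (h := fun j : nat => (n, j))); first last.
- move=> [m j]; rewrite scaler_eq0 negb_or => /andP[_]; rewrite prod_at21E /= !exE.
  case: ifP; rewrite ?eqxx // => /eqP; rewrite en => E _; exists j; congr pair.
  by apply: (@intr_inj rat); move: E; lra.
- by move=> j j' [].
apply: eq_ssum => j /=; rewrite mulr1; congr (_ *: _).
rewrite prod_at21E !exE en; case: eqP => [_|[]]; last by lra.
by congr (B _ (A _ w)); lra.
Qed.

Lemma jacobi_lhs_int (n : int) e : ex0 e = - n%:~R - 1 ->
  jacobi_lhs A B w e =
  \sum_(j \in [set: nat]) (((-1) ^+ j * binr K n%:~R j)
     *: A (ex1 e - n%:~R + j%:R) (B (ex2 e - j%:R) w))
  - \sum_(j \in [set: nat]) (((-1) ^ n * ((-1) ^+ j * binr K n%:~R j))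
     *: B (ex2 e - n%:~R + j%:R) (A (ex1 e - j%:R) w)).
Proof. by move=> en; rewrite -(jacobi_term1 en) -(jacobi_term2 en). Qed.

Lemma jacobi_lhs_nint e : (forall n : int, ex0 e <> - n%:~R - 1) ->
  jacobi_lhs A B w e = 0.
Proof.
move=> en.
have e0 (m : int) : (ex0 e - -1 - - m%:~R == 0) = false.
  by apply/eqP => E; apply: (en m); lra.
have z1 :
    ((x0inv K ** delta_sub (1 : K) x1 x2 x0 1) ** prod_at x1 A x2 B w) e = 0.
  rewrite conv_mono_conv (delta_subE _ delta12_inj).
  rewrite (conv_fsum_mono _ _ _ delta12_inj); apply: ssum0 => -[m j].
  by rewrite prod_at12E !exE e0 scaler0.
have z2 :
    ((x0inv K ** delta_sub (-1 : K) x2 x1 x0 1) ** prod_at x2 B x1 A w) e = 0.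
  rewrite conv_mono_conv (delta_subE _ delta21_inj).
  rewrite (conv_fsum_mono _ _ _ delta21_inj); apply: ssum0 => -[m j].
  by rewrite prod_at21E !exE e0 scaler0.
by rewrite -[RHS](subrr 0) -{1}z1 -z2.
Qed.

End JacobiLhs.

Section IterTerm.
Variables (p : nat) (hp : (0 < p)%N).

Lemma pq0 : p%:R != 0 :> rat. Proof. by rewrite pnatr_eq0 -lt0n. Qed.

Lemma divp_inj : injective (fun m : int => m%:~R * p%:R^-1 : rat).
Proof. by move=> m n /(mulIf (invr_neq0 pq0))/intr_inj. Qed.

Lemma delta_iter_inj : injective (fun nj : int * nat =>
  (nj.1%:~R * p%:R^-1 - nj.2%:R) *: x1 + nj.2%:R *: x0
    - (nj.1%:~R * p%:R^-1) *: x2).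
Proof.
by move=> [n j] [n' j'] /= E; exinj E => /oppr_inj/divp_inj -> _ /natr_inj ->.
Qed.

Variables (V : zmodType) (M : lmodType K) (a : K).
Variables (A : rat -> V -> V) (B : V -> rat -> M -> M) (v : V) (w : M).

(** The exponent [n/p - j] of [x1] equals [m/p], so that [n = m + j p]. *)
Lemma iter_term_int (m : int) e : ex1 e * p%:R = m%:~R ->
  ((x2inv K ** delta_sub a x1 x0 x2 p%:R^-1) ** iter_at A B v w) e =
  \sum_(j \in [set: nat]) ((a ^ (m + j%:Z * p%:Z)
      * ((-1) ^+ j * binr K (ex1 e + j%:R) j))
    *: B (A (ex0 e - j%:R) v) (ex2 e + 1 + ex1 e + j%:R) w).
Proof.
have p0 := pq0.
move=> em; rewrite conv_mono_conv (delta_subE _ delta_iter_inj).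
rewrite (conv_fsum_mono _ _ _ delta_iter_inj).
rewrite (ssum_reindex (h := fun j : nat => (m + j%:Z * p%:Z, j))); first last.
- move=> [n j]; rewrite scaler_eq0 negb_or => /andP[_]; rewrite iter_atE /= !exE.
  case: ifP; rewrite ?eqxx // => /eqP E _; exists j; congr pair.
  apply: (@intr_inj rat); rewrite rmorphD rmorphM /= -em -!pmulrn.
  have {E} : ex1 e = n%:~R * p%:R^-1 - j%:R by move: E; lra.
  by move=> ->; field.
- by move=> j j' [].
apply: eq_ssum => j /=.
have E : (m + j%:Z * p%:Z)%:~R * p%:R^-1 = ex1 e + j%:R :> rat.
  by rewrite rmorphD rmorphM /= -em -!pmulrn; field.
rewrite E; congr (_ *: _).
rewrite iter_atE !exE; case: eqP => [_|[]]; last by ring.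
by congr (B (A _ v) _ w); ring.
Qed.

Lemma iter_term_nint e : (forall m : int, ex1 e * p%:R <> m%:~R) ->
  ((x2inv K ** delta_sub a x1 x0 x2 p%:R^-1) ** iter_at A B v w) e = 0.
Proof.
have p0 := pq0.
move=> em; rewrite conv_mono_conv (delta_subE _ delta_iter_inj).
rewrite (conv_fsum_mono _ _ _ delta_iter_inj).
apply: ssum0 => -[m j]; rewrite iter_atE /= !exE; case: eqP; rewrite ?scaler0 // => E.
case: (em (m - j%:Z * p%:Z)); rewrite rmorphB rmorphM /= -!pmulrn.
have {E} : ex1 e = m%:~R * p%:R^-1 - j%:R by move: E; lra.
by move=> ->; field.
Qed.

Lemma delta_exp_inj : injective (fun km : int * int =>
  km.1%:~R *: (x0 - x2) + (km.2%:~R * p%:R^-1) *: (x2 - x1)).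
Proof.
move=> [k m] [k' m'] /= E; exinj E => _.
by rewrite !mulrN1 => /oppr_inj/divp_inj -> /intr_inj ->.
Qed.

Lemma ypow_inj : injective (fun k : int => k%:~R *: (x0 - x2)).
Proof. by move=> k k' E; exinj E => _ _ /intr_inj. Qed.

Lemma ypow_conv (W : lmodType K) n (F : expo -> W) e :
  (ypow K n ** F) e =
  \sum_(k \in [set: int]) (logpow K n k *: F (e - k%:~R *: (x0 - x2))).
Proof. exact: (conv_fsum_mono _ _ _ ypow_inj). Qed.

(** [delta(a (e^y x2 / x1)^(1/p))] at [y = log (1 + x0/x2)] is the sum over [m]
    of [a^m (1 + x0/x2)^(m/p) (x2/x1)^(m/p)]. *)
Lemma delta_expE :
  delta_exp a p%:R^-1 =
  fsum (fun km : int * int =>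
    mono (km.1%:~R *: (x0 - x2) + (km.2%:~R * p%:R^-1) *: (x2 - x1))
      (a ^ km.2 * binser K (km.2%:~R * p%:R^-1) km.1 : K^o)).
Proof.
have ms_inj : injective (fun m : int => (m%:~R * p%:R^-1) *: (x2 - x1)).
  by move=> m m' E; exinj E => /divp_inj.
apply/funext => e.
have [[[k m] ->]|none] := pselect (exists km : int * int,
    e = km.1%:~R *: (x0 - x2) + (km.2%:~R * p%:R^-1) *: (x2 - x1)).
  rewrite (fsum_mono _ _ delta_exp_inj) /= /delta_exp /ysubst.
  rewrite -logsub_lexp -[RHS]/(_ *: _) ssumZ; apply: eq_ssum => n.
  rewrite ypow_conv (ssum1 (i0 := k)).
    rewrite addrAC subrr add0r.
    rewrite (_ : fsum _ _ = a ^ m * lexp K (m%:~R * p%:R^-1) n); last first.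
      exact: (fsum_mono _ m ms_inj).
    by rewrite /GRing.scale /=; ring.
  move=> k' kk'; suff -> : fsum (fun m0 : int =>
      mono ((m0%:~R * p%:R^-1) *: (x2 - x1))
        (a ^ m0 * lexp K (m0%:~R * p%:R^-1) n : K^o))
      (k%:~R *: (x0 - x2) + (m%:~R * p%:R^-1) *: (x2 - x1) - k'%:~R *: (x0 - x2)) = 0.
    by rewrite scaler0.
  apply: fsum_mono0 => m' E; move/eqP: kk'; apply.
  by exinj E => _ _ /eqP; rewrite subr_eq0 => /eqP/intr_inj.
rewrite fsum_mono0 => [|km ekm]; last by apply: none; exists km.
apply: ssum0 => n; rewrite ypow_conv; apply: ssum0 => k.
rewrite fsum_mono0 ?scaler0 // => m E; apply: none; exists (k, m) => /=.
by rewrite -E addrC subrK.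
Qed.

End IterTerm.

Section ExpTerm.
Variables (p : nat) (hp : (0 < p)%N) (M : lmodType K) (a : K).
Variables (D : int -> rat -> M -> M) (w : M).

Lemma ysubst_op_int (n : int) e : ex1 e = 0 -> ex0 e = n%:~R ->
  ysubst (fun n => op_at x2 (D n) w) e =
  \sum_(l \in [set: int]) (logpow K l n *: D l (ex2 e + ex0 e) w).
Proof.
move=> e1 e0; apply: eq_ssum => l; rewrite ypow_conv (ssum1 (i0 := n)).
  by rewrite op_at2E !exE e1 e0 subrr !eqxx /= mulrN1 opprK.
move=> k kn; rewrite op_at2E !exE e0 subr_eq0 eqr_int eq_sym (negPf kn).
by rewrite scaler0.
Qed.

Lemma ysubst_op0 e : ex1 e <> 0 \/ (forall n : int, ex0 e <> n%:~R) ->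
  ysubst (fun n => op_at x2 (D n) w) e = 0.
Proof.
move=> e01; apply: ssum0 => l; rewrite ypow_conv; apply: ssum0 => k.
rewrite op_at2E !exE; case: andP => [[/eqP E0 /eqP E1]|_]; rewrite ?scaler0 //.
by case: e01 => [//|/(_ k)[]]; apply/eqP; rewrite -subr_eq0 E0.
Qed.

(** The exponent of [x1] selects the term of index [- (m + p)] in the delta
    series; [k] is the power of [x0] taken from that term, and [- n - 1 - k] the
    one taken from the other factor. *)
Lemma exp_term_int (m n : int) e : ex1 e * p%:R = m%:~R -> ex0 e = - n%:~R - 1 ->
  ((x1inv K ** delta_exp a p%:R^-1) ** ysubst (fun n => op_at x2 (D n) w)) e =
  \sum_(k \in [set: int]) ((a ^ (- (m + p%:Z)) * binser K (- ex1 e - 1) k) *: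
    (\sum_(l \in [set: int]) (logpow K l (- n - 1 - k) *:
       D l (ex2 e + ex1 e + 1 + ex0 e) w))).
Proof.
have p0 := pq0 hp.
move=> em en; rewrite conv_mono_conv (delta_expE hp).
rewrite (conv_fsum_mono _ _ _ (delta_exp_inj hp)).
rewrite (ssum_reindex (h := fun k : int => (k, - (m + p%:Z)))); first last.
- move=> [k m']; rewrite scaler_eq0 negb_or => /andP[_] nz; exists k; congr pair.
  apply: contrapT => mm'; move/eqP: nz; apply; apply: ysubst_op0; left.
  rewrite !exE => E; apply: mm'; apply: (@intr_inj rat).
  rewrite rmorphN rmorphD /= -em -!pmulrn.
  have {E} : ex1 e = - (m'%:~R * p%:R^-1) - 1 by move: E; lra.
  by move=> ->; field.
- by move=> k k' [].
apply: eq_ssum => k /=.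
have E : (- (m + p%:Z))%:~R * p%:R^-1 = - ex1 e - 1 :> rat.
  by rewrite rmorphN rmorphD /= -em -!pmulrn; field.
rewrite E; congr (_ *: _); rewrite (@ysubst_op_int (- n - 1 - k)).
- by apply: eq_ssum => l; congr (_ *: D l _ w); rewrite !exE; ring.
- by rewrite !exE; ring.
- by rewrite !exE en !rmorphB rmorphN /=; ring.
Qed.

Lemma exp_term_nint e : (forall m : int, ex1 e * p%:R <> m%:~R) \/
    (forall n : int, ex0 e <> - n%:~R - 1) ->
  ((x1inv K ** delta_exp a p%:R^-1) ** ysubst (fun n => op_at x2 (D n) w)) e = 0.
Proof.
have p0 := pq0 hp.
move=> e01; rewrite conv_mono_conv (delta_expE hp).
rewrite (conv_fsum_mono _ _ _ (delta_exp_inj hp)).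
apply: ssum0 => -[k m]; rewrite ysubst_op0 ?scaler0 //= !exE.
case: e01 => [/(_ (- m - p%:Z)) em|en].
  left=> E; apply: em; rewrite rmorphB rmorphN /= -!pmulrn.
  have {E} : ex1 e = - (m%:~R * p%:R^-1) - 1 by move: E; lra.
  by move=> ->; field.
right=> n E; apply: (en (- n - k - 1)).
by rewrite !rmorphB rmorphN /=; move: E; lra.
Qed.

End ExpTerm.

Section Vop.
Variables (V : Type) (M : zmodType) (p : nat) (hp : (0 < p)%N).
Variables (Y : V -> int -> M -> M) (v : V) (w : M).

Lemma vop_int (k : int) s : s = - (k%:~R / p%:R) - 1 -> vop p Y v s w = Y v k w.
Proof.
move=> ->; rewrite /vop (ssum1 (i0 := k)) ?eqxx // => k' kk'.
case: eqP => // /addIr/oppr_inj/(divp_inj hp) E.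
by rewrite E eqxx in kk'.
Qed.

Lemma vop_nint s : (forall k : int, s <> - (k%:~R / p%:R) - 1) -> vop p Y v s w = 0.
Proof. by move=> sk; apply: ssum0 => k; case: eqP => // /sk. Qed.

End Vop.

End Coefficients.

(** * Gradings *)

Lemma fsupp_finite (I : choiceType) (W : zmodType) (f : I -> W) :
  finite_set [set i | f i <> 0]%classic <-> fsupp f.
Proof.
split=> [/finite_fsetP[X XE]|[r fr]].
  exists (finmap.enum_fset X) => i /eqP fi.
  by move/seteqP: XE => [/(_ i fi)].
apply: (@sub_finite_set _ _ [set` r]%classic); last exact: finite_seq.
by move=> i /= /eqP/fr.
Qed.

Section LinearMaps.
Variables (K : numFieldType) (V W : lmodType K) (f : V -> W) (fl : linear f).

Lemma linear_add x y : f (x + y) = f x + f y.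
Proof. by have := fl 1 x y; rewrite !scale1r. Qed.

Lemma linear_zero : f 0 = 0.
Proof. by apply: (addrI (f 0)); rewrite -linear_add !addr0. Qed.

Lemma linear_scale a x : f (a *: x) = a *: f x.
Proof. by have := fl a x 0; rewrite linear_zero !addr0. Qed.

End LinearMaps.

Section Gradings.
Variables (K : numFieldType) (I : numDomainType) (V : lmodType K).
Variables (S : I -> set V) (gS : is_grading S).

Lemma gr_add n u v : S n u -> S n v -> S n (u + v).
Proof. by have [_ Sl] := gr_subspace gS n => /(Sl 1 u v)/[apply]; rewrite scale1r. Qed.

Lemma gr_zero n : S n 0.
Proof. by have [] := gr_subspace gS n. Qed.

Lemma gr_scale n a u : S n u -> S n (a *: u).
Proof.
by have [S0 Sl] := gr_subspace gS n => /(Sl a u 0)/(_ S0); rewrite addr0.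
Qed.

Lemma gcompP u : decomposes S u (gcomp S u).
Proof.
have [f [fP _]] := gr_direct gS u.
exact: (@xgetPex _ (fun=> 0) [set f : I -> V | decomposes S u f]%classic (ex_intro _ f fP)).
Qed.

Lemma gcomp_unique u f : decomposes S u f -> gcomp S u = f.
Proof.
by have [g [_ gu]] := gr_direct gS u => /gu <-; rewrite (gu _ (gcompP u)).
Qed.

Lemma gcomp_supp u : fsupp (gcomp S u).
Proof. by have [_ /fsupp_finite] := gcompP u. Qed.

Lemma gcompD u v : gcomp S (u + v) = (fun n => gcomp S u n + gcomp S v n).
Proof.
have [Su fu uE] := gcompP u; have [Sv fv vE] := gcompP v.
apply: gcomp_unique; split.
- by move=> n; apply: gr_add.
- by apply/fsupp_finite/fsuppD; apply/gcomp_supp.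
- by rewrite ssumD -?uE -?vE //; apply: gcomp_supp.
Qed.

Lemma gcompZ a u : gcomp S (a *: u) = (fun n => a *: gcomp S u n).
Proof.
have [Su fu uE] := gcompP u; apply: gcomp_unique; split.
- by move=> n; apply: gr_scale.
- by apply/fsupp_finite; apply: fsupp_sub (gcomp_supp u) _ => n ->; rewrite scaler0.
- by rewrite -ssumZ -uE.
Qed.

Lemma gcomp_hom h u : S h u -> gcomp S u = mono h u.
Proof.
move=> Su; apply: gcomp_unique; split.
- by move=> n; rewrite /mono; case: eqP => [->//|_]; exact: gr_zero.
- apply/fsupp_finite; exists [:: h] => n; rewrite inE /mono.
  by case: ifP => //; rewrite eqxx.
- by rewrite (ssum1 (i0 := h)) /mono ?eqxx // => n /negPf ->.
Qed.

(** Every vector is a sum of homogeneous ones. *)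
Lemma homogeneous_ind (P : V -> Prop) :
  (forall h u, S h u -> P u) -> (forall u v, P u -> P v -> P (u + v)) ->
  forall u, P u.
Proof.
move=> Ph PD u; have [Su /fsupp_finite[r fr] ->] := gcompP u.
rewrite (ssum_undup fr); apply: big_ind => //.
  exact: (Ph 0 _ (gr_zero 0)).
by move=> n _; exact: Ph (Su n).
Qed.

(** An eigenvector of the grading operator is homogeneous. *)
Lemma gr_eigen (L : V -> V) (wt : I -> K) h x :
  injective wt -> linear L -> (forall n u, S n u -> L u = wt n *: u) ->
  L x = wt h *: x -> S h x.
Proof.
move=> wi Ll Lwt Lx; have [Sx fx xE] := gcompP x.
have sx := gcomp_supp x.
have E : gcomp S (wt h *: x) = (fun n => wt n *: gcomp S x n).
  apply: gcomp_unique; split.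
  - by move=> n; apply: gr_scale.
  - by apply/fsupp_finite; apply: fsupp_sub sx _ => n ->; rewrite scaler0.
  - rewrite -Lx {1}xE (ssum_morph (linear_zero Ll) (linear_add Ll) sx).
    by apply: eq_ssum => n; apply: Lwt.
suff -> : x = gcomp S x h by [].
rewrite {1}xE (ssum1 (i0 := h)) // => n nh.
move: E; rewrite gcompZ => /(congr1 (fun f => f n))/eqP.
rewrite -subr_eq0 -scalerBl scaler_eq0 subr_eq0 (inj_eq wi) eq_sym (negPf nh) /=.
by move/eqP.
Qed.

End Gradings.

(** * Vertex operator algebras *)

Section Voa.
Variables (K : numFieldType) (V : voa K).
Implicit Types u v w : V.

Notation Y := (@vY K V).
Notation L0 := (@vL K V 0).
Let gV := v_grading V.

Lemma vYDl u u' n w : Y (u + u') n w = Y u n w + Y u' n w.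
Proof. exact: (linear_add (v_linearl n w)). Qed.

Lemma vYDr u n w w' : Y u n (w + w') = Y u n w + Y u n w'.
Proof. exact: (linear_add (v_linearr u n)). Qed.

Lemma vYZl a u n w : Y (a *: u) n w = a *: Y u n w.
Proof. exact: (linear_scale (v_linearl n w)). Qed.

Lemma L0_linear : linear L0. Proof. exact: v_linearr. Qed.

Lemma L0_gr h u : L0 u = h%:~R *: u -> vgr h u.
Proof.
move=> E; apply: (gr_eigen gV _ L0_linear _ E); last exact: v_L0.
exact: intr_inj.
Qed.

(** The commutator [[omega_1, u_m]], read off the Jacobi identity at
    [x0^-1 x1^-2 x2^(- m - 1)]. *)
Lemma L0_vY u m v : L0 (Y u m v) - Y u m (L0 v) =
  Y (vL (-1) u) (m + 1) v + Y (L0 u) m v.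
Proof.
pose e : expo := (-1, -2%:R, - m%:~R - 1).
have e0 : ex0 e = - 0%:~R - 1 by rewrite /ex0 /=; ring.
have e1 : ex1 e * 1%:R = (-2)%:~R by rewrite /ex1 /=; ring.
have := congr1 (fun f => f e) (v_jacobi (vomega V) u v).
(* The exponent [1] in the delta series is [1/p] for [p = 1]. *)
rewrite (jacobi_lhs_int _ _ _ e0) -[X in delta_sub _ _ _ _ X]invr1.
rewrite (iter_term_int _ _ _ _ _ _ e1) //.
have b0 (j : nat) : j != 0%N -> binr K 0%:~R j = 0.
  by rewrite -lt0n => /binr_small.
rewrite (ssum1 (i0 := 0%N)) => [|j /b0 ->]; last by rewrite mulr0 scale0r.
rewrite (ssum1 (i0 := 0%N)) => [|j /b0 ->]; last by rewrite !mulr0 scale0r.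
have v1 (a : V) k s b : s = - k%:~R - 1 -> vop 1 Y a s b = Y a k b.
  by move=> ->; apply: vop_int; rewrite // divr1.
rewrite !binr0 expr0 expr0z !mul1r !scale1r.
have ew : ex1 e = -2%:R by [].
have em : ex2 e = - m%:~R - 1 by [].
rewrite (v1 (vomega V) 1 (ex1 e - 0%:R)); last by rewrite ew; ring.
rewrite (v1 (vomega V) 1 (ex1 e - 0%:~R + 0%:R)); last by rewrite ew; ring.
rewrite (v1 u m (ex2 e - 0%:R)); last by rewrite em; ring.
rewrite (v1 u m (ex2 e - 0%:~R + 0%:R)); last by rewrite em; ring.
(* Only [j = 0] and [j = 1] contribute, since [binom(j - 2, j) = 0] beyond. *)
move=> ->; rewrite (ssum_nat (N := 2)) => [|j j2]; last first.
  have -> : ex1 e + j%:R = (j - 2)%N%:R by rewrite natrB // ew addrC.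
  by rewrite binr_small ?mulr0 ?scale0r //; lia.
rewrite big_ord_recl big_ord1 /= !exp1rz !mul1r /bump /= !addn0.
rewrite expr1 binr0 scale1r.
have -> : binr K (ex1 e + 1%:R) 1 = -1.
  by rewrite ew /binr big_ord1 divr1 -[RHS](rmorphN1 (@ratr K)); congr ratr; ring.
rewrite mulrNN mulr1 scale1r.
rewrite (v1 (vomega V) 0 (ex0 e - 0%:R)); last by rewrite e0; ring.
rewrite (v1 (vomega V) 1 (ex0 e - 1%:R)); last by rewrite e0; ring.
rewrite (v1 _ (m + 1)); last by rewrite ew em rmorphD /=; ring.
by rewrite (v1 _ m) //; rewrite ew em; ring.
Qed.

Lemma L0_vY_hom h u m v : vgr h u ->
  L0 (Y u m v) = Y u m (L0 v) + (h - m - 1)%:~R *: Y u m v.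
Proof.
move=> hu; apply/eqP; rewrite addrC -subr_eq L0_vY (v_L0 hu) vYZl.
have := v_deriv u (- m%:~R - 2%:R) v.
rewrite /dvop (@vop_int _ _ 1 _ _ _ _ (m + 1)) //; last first.
  by rewrite divr1 rmorphD /=; ring.
rewrite (@vop_int _ _ 1 _ _ _ _ m) //; last by rewrite divr1; ring.
move=> ->; rewrite -scalerDl; apply/eqP; congr (_ *: _).
have -> : - m%:~R - 2%:R + 1 = (- m - 1)%:~R :> rat by rewrite rmorphB rmorphN /=; ring.
by rewrite ratr_int -rmorphD; congr (_%:~R); lia.
Qed.

(** [u_m v] has weight [wt u + wt v - m - 1]. *)
Lemma vgr_vY h h' u v m : vgr h u -> vgr h' v -> vgr (h + h' - m - 1) (Y u m v).
Proof.
move=> hu hv; apply: L0_gr; rewrite (L0_vY_hom _ _ hu) (v_L0 hv).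
rewrite (linear_scale (v_linearr u m)) -scalerDl -rmorphD.
by congr (_%:~R *: _); lia.
Qed.

Lemma vgr_aut nu h u r : voa_aut nu -> vgr h u -> vgr h (iter r nu u).
Proof.
move=> nuP hu; elim: r => //= r IH; apply: L0_gr.
rewrite /vL -{1}(aut_omega nuP) -(aut_Y nuP) -/(vL 0 _) (v_L0 IH).
exact: (linear_scale (aut_linear nuP)).
Qed.

(** ** Zhu's operators *)

(** The truncation bound can be chosen uniformly over the vectors
    [L(0)^k u]. *)
Lemma vY_trunc_L0 u v :
  exists N : int, forall k m, N <= m -> Y (iter k L0 u) m v = 0.
Proof.
elim/(homogeneous_ind gV): u => [h u hu|u u' [N uN] [N' uN']].
  have [N uN] := v_trunc u v; exists N => k m /uN um.
  elim: k => //= k IH; rewrite (_ : L0 _ = h%:~R *: iter k L0 u) ?vYZl ?IH ?scaler0 //.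
  apply: v_L0; elim: k {IH} => //= k IH; rewrite (v_L0 IH); exact (gr_scale gV _ IH).
exists (Num.max N N') => k m; rewrite ge_max => /andP[Nm Nm'].
have -> : iter k L0 (u + u') = iter k L0 u + iter k L0 u'.
  by elim: k => //= k ->; exact: (linear_add L0_linear).
by rewrite vYDl uN ?uN' ?addr0.
Qed.

Notation E := (@lexpm1 K).

Lemma Yexpm1_supp N a v n m : (forall m, N <= m -> Y a m v = 0) ->
  lpow E (- m - 1) n *: Y a m v != 0 -> - n - 1 <= m <= N - 1.
Proof.
move=> aN; rewrite scaler_eq0 negb_or => /andP[/(val_geP (@val_ge_lpow_lexpm1 _ _)) ?].
case: (ltP m N) => [? _|/aN ->]; last by rewrite eqxx.
by apply/andP; split; lia.
Qed.

Lemma val_ge_Yexpm1 N a v : (forall m, N <= m -> Y a m v = 0) ->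
  val_ge (- N) (Yexpm1 a v).
Proof.
move=> aN n nN; apply: ssum0 => m; apply/eqP; apply: contraTT isT.
by move/(Yexpm1_supp aN); lia.
Qed.

Lemma Yexpm1Dl a a' v n : Yexpm1 (a + a') v n = Yexpm1 a v n + Yexpm1 a' v n.
Proof.
have [N aN] := v_trunc a v; have [N' aN'] := v_trunc a' v.
rewrite /Yexpm1 -ssumD; first last.
- by apply: fsupp_int => m; exact: Yexpm1_supp aN'.
- by apply: fsupp_int => m; exact: Yexpm1_supp aN.
by apply: eq_ssum => m; rewrite vYDl scalerDr.
Qed.

Lemma Yexpm1Dr a v v' n : Yexpm1 a (v + v') n = Yexpm1 a v n + Yexpm1 a v' n.
Proof.
have [N aN] := v_trunc a v; have [N' aN'] := v_trunc a v'.
rewrite /Yexpm1 -ssumD; first last.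
- by apply: fsupp_int => m; exact: Yexpm1_supp aN'.
- by apply: fsupp_int => m; exact: Yexpm1_supp aN.
by apply: eq_ssum => m; rewrite vYDr scalerDr.
Qed.

Lemma fsupp_Ybracket u v n :
  fsupp (fun k : nat => k`!%:R^-1 *: Yexpm1 (iter k L0 u) v (n - k%:Z)).
Proof.
have [N uN] := vY_trunc_L0 u v.
apply: (@fsupp_nat _ _ (absz (n + N))) => k; rewrite scaler_eq0 negb_or => /andP[_].
by move/(val_geP (val_ge_Yexpm1 (uN k))); lia.
Qed.

Lemma val_ge_Ybracket u v : exists N, val_ge N (Ybracket u v).
Proof.
have [N uN] := vY_trunc_L0 u v; exists (- N) => n nN; apply: ssum0 => k.
by rewrite (val_ge_Yexpm1 (uN k)) ?scaler0 //; lia.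
Qed.

Lemma YbracketDl u u' v n : Ybracket (u + u') v n = Ybracket u v n + Ybracket u' v n.
Proof.
rewrite /Ybracket -ssumD; try exact: fsupp_Ybracket.
apply: eq_ssum => k.
have -> : iter k L0 (u + u') = iter k L0 u + iter k L0 u'.
  by elim: k => //= k ->; exact: (linear_add L0_linear).
by rewrite Yexpm1Dl scalerDr.
Qed.

Lemma YbracketDr u v v' n : Ybracket u (v + v') n = Ybracket u v n + Ybracket u v' n.
Proof.
rewrite /Ybracket -ssumD; try exact: fsupp_Ybracket.
by apply: eq_ssum => k; rewrite Yexpm1Dr scalerDr.
Qed.

(** On [u] of weight [h], [Y[u,y]v] is the sum of the
    [e^{h y} (e^y - 1)^{- m - 1} u_m v]. *)
Lemma Ybracket_hom h u v n : vgr h u ->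
  Ybracket u v n = \sum_(m \in [set: int])
    ((lexp K h%:~R ** lpow E (- m - 1)) n *: Y u m v).
Proof.
move=> hu; have [N uN] := v_trunc u v.
have L0k k : iter k L0 u = (h%:~R ^+ k : K) *: u.
  elim: k => [|k IH] /=; first by rewrite expr0 scale1r.
  by rewrite IH (v_L0 (gr_scale gV _ hu)) scalerA -exprS.
have l0 : val_ge 0 (lexp K h%:~R) by case.
have b k m : (lexp K h%:~R k * lpow E (- m - 1) (n - k)) *: Y u m v != 0 ->
    0 <= k <= n + N /\ - n - 1 <= m <= N.
  rewrite -scalerA scaler_eq0 negb_or => /andP[/(val_geP l0) ?].
  by move/(Yexpm1_supp uN) => ?; split; lia.
transitivity (\sum_(k \in [set: int]) \sum_(m \in [set: int])
    ((lexp K h%:~R k * lpow E (- m - 1) (n - k)) *: Y u m v)).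
  rewrite ssum_posz => [|k k0]; last first.
    by apply: ssum0 => m; rewrite l0 // mul0r scale0r.
  apply: eq_ssum => k; rewrite ssumZ; apply: eq_ssum => m.
  rewrite L0k vYZl !scalerA /= ratr_int; congr (_ *: _).
  by ring.
rewrite (@ssum_exchange_int _ _ 0 (n + N) (- n - 1) N) //.
apply: eq_ssum => m; rewrite /conv ssumZl //.
apply: (@fsupp_int _ _ 0 (n - (- m - 1))) => k.
exact: conv_supp l0 (@val_ge_lpow_lexpm1 _ _).
Qed.

End Voa.

(** * Additivity of the two sides *)

(** The exponents of [x] in [A(x) w] are bounded below. *)
Definition truncated (M : zmodType) (A : rat -> M -> M) (w : M) : Prop :=
  exists N : rat, forall s, s < N -> A s w = 0.

Lemma fsupp_truncated (W : zmodType) (N c : rat) (F : nat -> W) :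
  (forall j : nat, c - j%:R < N -> F j = 0) -> fsupp F.
Proof.
move=> F0; apply: (@fsupp_nat _ _ (Num.bound `|c - N|)) => j.
rewrite leqNgt; apply: contraNN => jb; apply/eqP/F0.
have := archi_boundP (normr_ge0 (c - N)); have := ler_norm (c - N).
have : (Num.bound `|c - N|)%:R < j%:R :> rat by rewrite ltr_nat.
by lra.
Qed.

Section JacobiAdditive.
Variables (K : numFieldType) (M : lmodType K).
Implicit Types (A B : rat -> M -> M) (w : M).

(** Each coefficient of [A(x)] is an additive map. *)
Definition additive_op A : Prop :=
  (forall s, A s 0 = 0) /\ forall s w w', A s (w + w') = A s w + A s w'.

Lemma fsupp_mode B w (f : rat) : truncated B w ->
  fsupp (fun j : nat => B (f - j%:R) w).
Proof. by move=> [N BN]; apply: (@fsupp_truncated _ N f) => j /BN. Qed.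

(* Finite support of [j |-> c j A (b j) (B (f - j) w)]. *)
Ltac solve_fsupp := match goal with
  | t : truncated ?B ?w, a : additive_op ?A |- fsupp (fun j => _ *: ?A _ (?B (?f - _) ?w)) =>
    by apply: (fsupp_sub (fsupp_mode f t)) => j ->; rewrite a.1 scaler0
  end.

Lemma jacobi_lhsDl A A' B w : truncated A w -> truncated A' w ->
  truncated B w -> additive_op A -> additive_op A' -> additive_op B ->
  jacobi_lhs (fun s x => A s x + A' s x) B w =
  (fun e => jacobi_lhs A B w e + jacobi_lhs A' B w e).
Proof.
move=> tA tA' tB aA aA' aB; apply/funext => e.
have [[n en]|en] := pselect (exists n : int, ex0 e = - n%:~R - 1); last first.
  by rewrite !jacobi_lhs_nint ?addr0 // => n en'; apply: en; exists n.
rewrite !(jacobi_lhs_int _ _ _ en) addrACA -opprD -!ssumD;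
  try solve_fsupp.
congr (_ - _); apply: eq_ssum => j; rewrite -scalerDr //.
by rewrite aB.2.
Qed.

Lemma jacobi_lhsDr A B B' w : truncated A w -> truncated B w ->
  truncated B' w -> additive_op A -> additive_op B -> additive_op B' ->
  jacobi_lhs A (fun s x => B s x + B' s x) w =
  (fun e => jacobi_lhs A B w e + jacobi_lhs A B' w e).
Proof.
move=> tA tB tB' aA aB aB'; apply/funext => e.
have [[n en]|en] := pselect (exists n : int, ex0 e = - n%:~R - 1); last first.
  by rewrite !jacobi_lhs_nint ?addr0 // => n en'; apply: en; exists n.
rewrite !(jacobi_lhs_int _ _ _ en) addrACA -opprD -!ssumD;
  try solve_fsupp.
congr (_ - _); apply: eq_ssum => j; rewrite -scalerDr //.
by rewrite aA.2.
Qed.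

(** The lower bound [N] on the powers of [y] makes all sums finite. *)
Lemma exp_termD (p : nat) (a : K) (D D' : int -> rat -> M -> M) N w e :
  (0 < p)%N -> (forall l s, l < N -> D l s w = 0) ->
  (forall l s, l < N -> D' l s w = 0) ->
  ((x1inv K ** delta_exp a p%:R^-1)
    ** ysubst (fun n => op_at x2 (fun s x => D n s x + D' n s x) w)) e =
  ((x1inv K ** delta_exp a p%:R^-1) ** ysubst (fun n => op_at x2 (D n) w)) e +
  ((x1inv K ** delta_exp a p%:R^-1) ** ysubst (fun n => op_at x2 (D' n) w)) e.
Proof.
move=> hp DN DN'.
have [[m em]|em] := pselect (exists m : int, ex1 e * p%:R = m%:~R); last first.
  by rewrite !exp_term_nint ?addr0 //; left=> m em'; apply: em; exists m.
have [[n en]|en] := pselect (exists n : int, ex0 e = - n%:~R - 1); last first.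
  by rewrite !exp_term_nint ?addr0 //; right=> n en'; apply: en; exists n.
rewrite !(exp_term_int hp _ _ _ em en).
have supp F k s : (forall l s, l < N -> F l s w = 0) ->
    fsupp (fun l : int => logpow K l k *: F l s w).
  move=> FN; apply: (@fsupp_int _ _ N k) => l; rewrite scaler_eq0 negb_or.
  move=> /andP[/(val_geP (@val_ge_logpow _ _)) -> ]; rewrite andbT leNgt.
  by apply: contraNN => /FN ->.
have supp2 F c s : (forall l s, l < N -> F l s w = 0) ->
    fsupp (fun k : int => (c * binser K (- ex1 e - 1) k) *:
      (\sum_(l \in [set: int]) (logpow K l (- n - 1 - k) *: F l s w))).
  move=> FN; apply: (@fsupp_int _ _ 0 (- n - 1 - N)) => k.
  rewrite scaler_eq0 mulf_eq0 !negb_or => /andP[/andP[_ /(val_geP (@val_ge_binser _ _)) ->]].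
  rewrite leNgt; apply: contraNN => kN; apply/eqP/ssum0 => l.
  case: (ltP l N) => [/FN ->|lN]; first by rewrite scaler0.
  by rewrite val_ge_logpow ?scale0r //; lia.
rewrite -ssumD; try exact: supp2.
apply: eq_ssum => k; rewrite -scalerDr -ssumD; try exact: supp.
by congr (_ *: _); apply: eq_ssum => l; rewrite scalerDr.
Qed.

End JacobiAdditive.

(** * Homogeneous twisted vertex operators *)

Section Twisted.
Variables (K : numFieldType) (V : voa K) (nu : V -> V) (p : nat) (hp : (0 < p)%N).
Variables (omega_p : K) (M : twisted_module nu p omega_p).
Implicit Types (u v : V) (w : M).

Let gV := v_grading V.
Notation tYM := (@tY _ _ _ _ _ M).
Notation Yt := (vop p tYM).

Lemma Yt_linearl s w : linear (fun v => Yt v s w).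
Proof.
move=> a u v; have [[k sk]|nk] := pselect (exists k : int, s = - (k%:~R / p%:R) - 1).
  by rewrite !(vop_int hp _ _ _ sk); exact: (t_linearl k w a u v).
by rewrite !vop_nint ?scaler0 ?addr0 // => k sk; apply: nk; exists k.
Qed.

Lemma Yt_linearr v s : linear (Yt v s).
Proof.
move=> a x y; have [[k sk]|nk] := pselect (exists k : int, s = - (k%:~R / p%:R) - 1).
  by rewrite !(vop_int hp _ _ _ sk); exact: (t_linearr v k a x y).
by rewrite !vop_nint ?scaler0 ?addr0 // => k sk; apply: nk; exists k.
Qed.

Lemma Yt_truncated v w : truncated (Yt v) w.
Proof.
have [N vN] := t_trunc v w; exists (- (N%:~R / p%:R) - 1) => s sN.
have [[k sk]|nk] := pselect (exists k : int, s = - (k%:~R / p%:R) - 1); last first.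
  by apply: vop_nint => k sk; apply: nk; exists k.
rewrite (vop_int hp _ _ _ sk) vN // -(ler_int rat).
have p0 : 0 < p%:R^-1 :> rat by rewrite invr_gt0 ltr0n.
by rewrite -(ler_pM2r p0); move: sN; rewrite sk; lra.
Qed.

Lemma XM_supp u s w :
  fsupp (fun n : int => Yt (gcomp (@vgr K V) u n) (s - n%:~R) w).
Proof.
apply: fsupp_sub (gcomp_supp gV u) _ => n ->.
exact: (linear_zero (Yt_linearl _ _)).
Qed.

Lemma XM_linearl s w : linear (fun u => XM M u s w).
Proof.
move=> a u v; rewrite /XM (gcompD gV) (gcompZ gV) ssumZ -ssumD.
- by apply: eq_ssum => n; exact: Yt_linearl.
- by apply: fsupp_sub (XM_supp u s w) _ => n ->; rewrite scaler0.
- exact: XM_supp.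
Qed.

Lemma XM_linearr u s : linear (XM M u s).
Proof.
move=> a x y; rewrite /XM ssumZ -ssumD.
- by apply: eq_ssum => n; exact: Yt_linearr.
- by apply: fsupp_sub (XM_supp u s x) _ => n ->; rewrite scaler0.
- exact: XM_supp.
Qed.

Lemma XM_additive u : additive_op (XM M u).
Proof.
split=> s; first exact: (linear_zero (XM_linearr u s)).
exact: (linear_add (XM_linearr u s)).
Qed.

Lemma XMD u v : XM M (u + v) = (fun s w => XM M u s w + XM M v s w).
Proof.
apply/funext => s; apply/funext => w; exact: (linear_add (XM_linearl s w)).
Qed.

(** [X_M(u, x) = x^h Y_M(u, x)] when [u] has weight [h]. *)
Lemma XM_hom h u s w : vgr h u -> XM M u s w = Yt u (s - h%:~R) w.
Proof.
move=> hu; rewrite /XM (gcomp_hom gV hu) (ssum1 (i0 := h)) /mono ?eqxx //.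
move=> n /negPf ->; exact: (linear_zero (Yt_linearl _ _)).
Qed.

Lemma XM_truncated u w : truncated (XM M u) w.
Proof.
elim/(homogeneous_ind gV): u => [h u hu|u v [N uN] [N' vN']].
  have [N uN] := Yt_truncated u w; exists (N + h%:~R) => s sN.
  by rewrite (XM_hom _ _ hu) uN // ltrBlDr.
exists (Num.min N N') => s; rewrite lt_min => /andP[sN sN'].
by rewrite XMD uN ?vN' ?addr0.
Qed.

Variables (hw : omega_p ^+ p = 1) (hnu : voa_aut nu).

(* The [r]-th summand of the right side. *)
Notation rhs_term u v w r :=
  ((x1inv K ** delta_exp (omega_p ^- r) (p%:R^-1))
      ** ysubst (fun n : int =>
           op_at x2 (XM M (Ybracket (iter r nu u) v n)) w)).

Lemma rhs_termDl u u' v w r e :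
  rhs_term (u + u') v w r e = rhs_term u v w r e + rhs_term u' v w r e.
Proof.
have -> : iter r nu (u + u') = iter r nu u + iter r nu u'.
  by elim: r => //= r ->; exact: (linear_add (aut_linear hnu)).
have [N uN] := val_ge_Ybracket (iter r nu u) v.
have [N' uN'] := val_ge_Ybracket (iter r nu u') v.
have -> : (fun n => op_at x2 (XM M (Ybracket (iter r nu u + iter r nu u') v n)) w) =
    (fun n => op_at x2 (fun s x => XM M (Ybracket (iter r nu u) v n) s x
                                   + XM M (Ybracket (iter r nu u') v n) s x) w).
  by apply/funext => n; rewrite YbracketDl XMD.
apply: (exp_termD (N := Num.min N N') _ _ hp).
- move=> l s; rewrite lt_min => /andP[/uN -> _].
  exact: (linear_zero (XM_linearl _ _)).
- move=> l s; rewrite lt_min => /andP[_ /uN' ->].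
  exact: (linear_zero (XM_linearl _ _)).
Qed.

Lemma rhs_termDr u v v' w r e :
  rhs_term u (v + v') w r e = rhs_term u v w r e + rhs_term u v' w r e.
Proof.
have [N uN] := val_ge_Ybracket (iter r nu u) v.
have [N' uN'] := val_ge_Ybracket (iter r nu u) v'.
have -> : (fun n => op_at x2 (XM M (Ybracket (iter r nu u) (v + v') n)) w) =
    (fun n => op_at x2 (fun s x => XM M (Ybracket (iter r nu u) v n) s x
                                   + XM M (Ybracket (iter r nu u) v' n) s x) w).
  by apply/funext => n; rewrite YbracketDr XMD.
apply: (exp_termD (N := Num.min N N') _ _ hp).
- move=> l s; rewrite lt_min => /andP[/uN -> _].
  exact: (linear_zero (XM_linearl _ _)).
- move=> l s; rewrite lt_min => /andP[_ /uN' ->].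
  exact: (linear_zero (XM_linearl _ _)).
Qed.

(** The factors [x1^h] and [x2^h'] of the homogeneous operators shift the
    exponents. *)
Lemma jacobi_lhs_hom h h' u v w e : vgr h u -> vgr h' v ->
  jacobi_lhs (XM M u) (XM M v) w e =
  jacobi_lhs (Yt u) (Yt v) w (e - h%:~R *: x1 - h'%:~R *: x2).
Proof.
move=> hu hv.
have [[n en]|en] := pselect (exists n : int, ex0 e = - n%:~R - 1); last first.
  by rewrite !jacobi_lhs_nint // => n en'; apply: en; exists n; move: en'; rewrite ?exE.
have en' : ex0 (e - h%:~R *: x1 - h'%:~R *: x2) = - n%:~R - 1 by rewrite !exE.
rewrite (jacobi_lhs_int _ _ _ en) (jacobi_lhs_int _ _ _ en').
have E1 (x a b c : rat) : x - a + b - c = x - c - a + b by ring.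
have E2 (x a c : rat) : x - a - c = x - c - a by ring.
congr (_ - _); apply: eq_ssum => j.
  by rewrite (XM_hom _ _ hu) (XM_hom _ _ hv) !exE E1 [ex2 e - _ - _]E2.
by rewrite (XM_hom _ _ hu) (XM_hom _ _ hv) !exE E1 [ex1 e - _ - _]E2.
Qed.

(** For [u] of weight [h], the series [X_M(Y[u,y]v, x2) w] at
    [y = log (1 + t)] is [(1 + t)^h X_M(Y(u, t)v, x2) w]; both sides are the
    coefficient of [t^k x2^s]. *)
Lemma logsub_XM_Ybracket h u v s w k : vgr h u ->
  \sum_(l \in [set: int]) (logpow K l k *: XM M (Ybracket u v l) s w) =
  \sum_(m \in [set: int]) (binser K h%:~R (k + m + 1) *: XM M (vY u m v) s w).
Proof.
move=> hu; have [N uN] := v_trunc u v.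
pose c m := lexp K h%:~R ** lpow (@lexpm1 K) (- m - 1).
have c_ge m : val_ge (- m - 1) (c m) by exact: val_ge_exp_lpow.
have XM0 : XM M 0 s w = 0 by exact: (linear_zero (XM_linearl _ _)).
have b l m : (logpow K l k * c m l) *: XM M (vY u m v) s w != 0 ->
    - N <= l <= k /\ - k - 1 <= m <= N.
  rewrite scaler_eq0 mulf_eq0 !negb_or => /andP[/andP[]].
  move=> /(val_geP (@val_ge_logpow _ _)) lk /(val_geP (@c_ge _)) ml.
  case: (ltP m N) => [? _|/uN ->]; last by rewrite XM0 eqxx.
  by split; lia.
transitivity (\sum_(l \in [set: int]) \sum_(m \in [set: int])
    ((logpow K l k * c m l) *: XM M (vY u m v) s w)).
  apply: eq_ssum => l; rewrite (Ybracket_hom _ _ hu).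
  rewrite (ssum_morph XM0 (linear_add (XM_linearl s w))).
    rewrite ssumZ; apply: eq_ssum => m.
    by rewrite (linear_scale (XM_linearl s w)) scalerA.
  apply: (@fsupp_int _ _ (- l - 1) N) => m; rewrite scaler_eq0 negb_or.
  move=> /andP[/(val_geP (@c_ge _)) ?].
  case: (ltP m N) => [? _|/uN ->]; last by rewrite eqxx.
  by lia.
rewrite (ssum_exchange_int b); apply: eq_ssum => m.
have -> : k + m + 1 = k - (- m - 1) by lia.
rewrite -logsub_exp_lpow -/(c m) ssumZl.
  by apply: eq_ssum => l; rewrite /GRing.scale /= mulrC.
by apply: (@fsupp_int _ _ (- m - 1) k) => l; exact: logsub_supp (@c_ge m).
Qed.

(** The [r]-th term on the right for [X_M] is [x1^h x2^h'] times the one for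
    [Y_M]. *)
Lemma rhs_term_hom h h' u v w r e : vgr h u -> vgr h' v ->
  rhs_term u v w r e =
  ((x2inv K ** delta_sub (omega_p ^+ r) x1 x0 x2 p%:R^-1)
     ** iter_at (vop 1 (@vY K V) (iter r nu u)) Yt v w)
    (e - h%:~R *: x1 - h'%:~R *: x2).
Proof.
move=> hu hv; have {hu} : vgr h (iter r nu u) by exact: vgr_aut.
move: (iter r nu u) => {}u hu; set e' := e - _ - _.
have p0 := pq0 hp.
have e'0 : ex0 e' = ex0 e by rewrite !exE.
have e'1 : ex1 e' = ex1 e - h%:~R by rewrite !exE.
have e'2 : ex2 e' = ex2 e - h'%:~R by rewrite !exE.
have [[m em]|em] := pselect (exists m : int, ex1 e * p%:R = m%:~R); last first.
  rewrite exp_term_nint // 1?iter_term_nint //.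
    move=> m; rewrite e'1 => em'; apply: em; exists (m + h * p%:Z).
    by rewrite rmorphD rmorphM /= -em' -pmulrn; ring.
  by left=> m em'; apply: em; exists m.
have em' : ex1 e' * p%:R = (m - h * p%:Z)%:~R.
  by rewrite e'1 mulrBl em rmorphB rmorphM /= -pmulrn.
rewrite (iter_term_int hp _ _ _ _ _ em').
have Yt0 s : Yt 0 s w = 0 by exact: (linear_zero (Yt_linearl _ _)).
have [[n en]|en] := pselect (exists n : int, ex0 e = - n%:~R - 1); last first.
  rewrite exp_term_nint //; last by right=> n en'; apply: en; exists n.
  apply/esym/ssum0 => j.
  rewrite (_ : vop 1 _ _ _ _ = 0) ?Yt0 ?scaler0 //; apply: vop_nint => k ek.
  by apply: en; exists (k - j%:Z); move: ek; rewrite e'0 divr1 rmorphB /= -pmulrn; lra.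
rewrite (exp_term_int hp _ _ _ em en).
set S := ex2 e + ex1 e + 1 + ex0 e.
pose T m' := XM M (vY u m' v) S w.
have [N uN] := v_trunc u v.
have T0 m' : N <= m' -> T m' = 0.
  by move=> /uN E; rewrite /T E; exact: (linear_zero (XM_linearl _ _)).
have b k m' : (binser K (- ex1 e - 1) k * binser K h%:~R (m' - n - k)) *: T m' != 0 ->
    0 <= k <= N - n /\ n <= m' <= N.
  rewrite scaler_eq0 mulf_eq0 !negb_or => /andP[/andP[]].
  move=> /(val_geP (@val_ge_binser _ _)) ? /(val_geP (@val_ge_binser _ _)) ?.
  by case: (ltP m' N) => [? _|/T0 ->]; [split; lia|rewrite eqxx].
set z := (omega_p ^- r) ^ _.
transitivity (z *: \sum_(k \in [set: int]) \sum_(m' \in [set: int])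
    ((binser K (- ex1 e - 1) k * binser K h%:~R (m' - n - k)) *: T m')).
  rewrite ssumZ; apply: eq_ssum => k; rewrite -scalerA; congr (_ *: _).
  rewrite (logsub_XM_Ybracket _ _ _ _ hu) ssumZ; apply: eq_ssum => m'.
  rewrite scalerA; congr (_ * _ *: _); congr (binser _ _ _); lia.
rewrite (ssum_exchange_int b).
transitivity (z *: \sum_(m' \in [set: int])
    (binser K (h%:~R - ex1 e - 1) (m' - n) *: T m')).
  congr (_ *: _); apply: eq_ssum => m'.
  have -> : h%:~R - ex1 e - 1 = (- ex1 e - 1) + h%:~R by ring.
  rewrite -(binser_conv _ (- ex1 e - 1)) /conv ssumZl //.
  apply: (@fsupp_int _ _ 0 (m' - n - 0)) => k.
  exact: conv_supp (@val_ge_binser _ _) (@val_ge_binser _ _).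
rewrite (ssum_shift n) ssum_posz => [|m' m0]; last first.
  by rewrite addrK val_ge_binser ?scale0r.
rewrite ssumZ; apply: eq_ssum => j; rewrite addrK scalerA.
have -> : vop 1 (@vY K V) u (ex0 e' - j%:R) v = vY u (j%:Z + n) v.
  by apply: vop_int => //; rewrite divr1 e'0 en rmorphD /= -pmulrn; ring.
rewrite /T (XM_hom _ _ (vgr_vY (j%:Z + n) hu hv)).
have -> : S - (h + h' - (j%:Z + n) - 1)%:~R = ex2 e' + 1 + ex1 e' + j%:R.
  rewrite /S en e'1 e'2 !rmorphB !rmorphD /= -pmulrn; ring.
congr (_ *: _).
have -> : h%:~R - ex1 e - 1 = - ex1 e' - 1 by rewrite e'1; ring.
rewrite /binser binr_negate; congr (_ * _).
rewrite /z exprz_inv opprK.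
(* The two exponents of [omega_p^r] differ by a multiple of [p]. *)
have wr0 : (omega_p ^+ r) ^+ p = 1 by rewrite exprAC hw expr1n.
have w0 : omega_p ^+ r != 0.
  by apply: contra_eq_neq wr0 => ->; rewrite expr0n gtn_eqF // eq_sym oner_eq0.
have wz (i l : int) : (omega_p ^+ r) ^ (i + l * p%:Z) = (omega_p ^+ r) ^ i.
  by rewrite expfzDr // mulrC [l * _]mulrC -exprz_exp -exprnP wr0 exp1rz mul1r.
have -> : m - h * p%:Z + j%:Z * p%:Z = m + (j%:Z - h) * p%:Z by ring.
by rewrite wz -[p%:Z]mul1r wz.
Qed.

(** The homogeneous twisted Jacobi identity, over any [numFieldType] and for
    any [omega_p] with [omega_p^p = 1]. *)
Theorem homogeneous_twisted_jacobi u v w :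
  jacobi_lhs (XM M u) (XM M v) w =
  (p%:R^-1 : K) *: \sum_(r < p) rhs_term u v w r.
Proof.
apply/funext => e.
pose P u v := jacobi_lhs (XM M u) (XM M v) w e =
  p%:R^-1 *: \sum_(r < p) rhs_term u v w r e.
suff : P u v.
  rewrite /P => ->; rewrite -[RHS]/(_ *: _); congr (_ *: _).
  by rewrite fct_sumE.
elim/(homogeneous_ind gV): u => [h u hu|u u' Pu Pu'].
  elim/(homogeneous_ind gV): v => [h' v hv|v v' Pv Pv'].
    rewrite /P (jacobi_lhs_hom _ _ hu hv) t_jacobi.
    rewrite -[LHS]/(_ *: _) fct_sumE; congr (_ *: _); apply: eq_bigr => r _.
    by rewrite (rhs_term_hom _ _ _ hu hv).
  rewrite /P XMD jacobi_lhsDr; try exact: XM_truncated; try exact: XM_additive.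
  rewrite Pv Pv' -scalerDr -big_split; congr (_ *: _).
  by apply: eq_bigr => r _; rewrite rhs_termDr.
rewrite /P XMD jacobi_lhsDl; try exact: XM_truncated; try exact: XM_additive.
rewrite Pu Pu' -scalerDr -big_split; congr (_ *: _).
by apply: eq_bigr => r _; rewrite rhs_termDl.
Qed.

End Twisted.

Theorem theorem4p5 (R : realType) (V : voa R[i]) (p : nat) (hp : (0 < p)%N)
    (omega_p : R[i]) (homega : p.-primitive_root omega_p)
    (nu : V -> V) (hnu : voa_aut nu) (hnup : forall v : V, iter p nu v = v)
    (M : twisted_module nu p omega_p) (u v : V) (w : M) :
  jacobi_lhs (XM M u) (XM M v) w =
  (p%:R^-1 : R[i]) *: \sum_(r < p)
    ((x1inv R[i] ** delta_exp (omega_p ^- r) (p%:R^-1))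
      ** ysubst (fun n : int =>
           op_at x2 (XM M (Ybracket (iter r nu u) v n)) w)).
Proof.
exact: (homogeneous_twisted_jacobi hp (prim_expr_order homega) hnu).
Qed.
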